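(* Suppose (P) is primal simple, with primal solution of rank $r_\star$, let $\rho>0$ be fixed, and let $k=r_\star$ in (AL-BM). Let $(X_\star,y_\star)$ be a strictly complementary optimal primal-dual pair of (P) and (D). Then there are constants $c,\bar c,\hat c>0$ and $q\in(0,1)$ such that for any $y\in\mathbb R^m$ with $\|y-y_\star\|_2\le c$ and any $F_1\in\mathbb R^{n\times k}$ with $\|F_1F_1^\top-X_\star\|_F\le\hat c$, the gradient descent iteration $F_{t+1}=F_t-\eta\nabla_F\bar{\mathcal L}_\rho(F_t,y)$, $t=1,2,\dots$, with any stepsize $\eta\in(\bar c/2,\bar c)$ satisfies for all $t\geq 1$ $$\|\Delta_{t+1}\|_F\le q^t\|\Delta_1\|_F .$$
   Context: $\mathbb S^n$: real symmetric $n\times n$ matrices with the trace inner product. Data: a linear map $\mathcal A:\mathbb S^n\to\mathbb R^m$ with adjoint $\mathcal A^*$, $C\in\mathbb S^n$, $b\in\mathbb R^m$; $Z(y)=C-\mathcal A^*y$. (P): minimize $\langle C,X\rangle$ subject to $\mathcal AX=b$, $X\succeq 0$. (D): maximize $\langle b,y\rangle$ subject to $Z(y)\succeq 0$. $\mathcal L_\rho(X,y)=\langle C,X\rangle+\langle y,b-\mathcal AX\rangle+\frac\rho2\|\mathcal AX-b\|_2^2$. (AL-P): minimize $\mathcal L_\rho(X,y)$ over $X\succeq0$. (AL-BM): minimize $\bar{\mathcal L}_\rho(F,y):=\mathcal L_\rho(FF^\top,y)$ over $F\in\mathbb R^{n\times k}$. Strong duality of (P),(D): an optimal primal-dual pair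 exists and $\langle C,X\rangle=\langle b,y\rangle$ for any optimal pair $(X,y)$. A pair of optimal solutions $(X_\star,y_\star)$ is strictly complementary if moreover $\operatorname{rank}(X_\star)+\operatorname{rank}(Z(y_\star))=n$. (P) is primal simple if strong duality holds, some optimal pair is strictly complementary, and the primal solution is unique. For the given $y$ (near $y_\star$, where (AL-P) has a unique solution), let $X_{y,\rho}$ be the solution of (AL-P) and $\mathcal F=\{F\in\mathbb R^{n\times k}: FF^\top=X_{y,\rho}\}$. $\Delta_t=F_t-F_{0,t}$, where $F_{0,t}\in\arg\min_{F'\in\mathcal F}\|F_t-F'\|_F$; thus $\|\Delta_t\|_F$ is the Frobenius distance from $F_t$ to $\mathcal F$. $\|\cdot\|_F$ is the Frobenius norm. *)

(* Defs.v *)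
From HB Require Import structures.
From mathcomp Require Import all_boot all_order all_algebra.
From mathcomp Require Import all_classical all_reals all_analysis.

Set Implicit Arguments.
Unset Strict Implicit.
Unset Printing Implicit Defensive.
Import Order.TTheory GRing.Theory Num.Theory.
Import numFieldNormedType.Exports.

Local Open Scope classical_set_scope.
Local Open Scope ring_scope.

Definition argmin (R : realType) (T : Type) (S : set T) (f : T -> R) : set T :=
  [set x | S x /\ forall z, S z -> f x <= f z].

Definition argmax (R : realType) (T : Type) (S : set T) (f : T -> R) : set T :=
  [set x | S x /\ forall z, S z -> f z <= f x].

(* The trace inner product. On symmetric matrices it is \tr (M *m N); on
   column vectors it is the Euclidean inner product. *)
Definition mxdot (R : realType) (p q : nat) (M N : 'M[R]_(p, q)) : R :=
  \tr (M^T *m N).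

(* Frobenius norm (the Euclidean norm on column vectors), as opposed to `|M|,
   which is the entrywise maximum norm. *)
Definition mxnormF (R : realType) (p q : nat) (M : 'M[R]_(p, q)) : R :=
  Num.sqrt (mxdot M M).

(* Gradient for the inner product mxdot: the matrix of partial derivatives. *)
Definition gradient (R : realType) (p q : nat) (f : 'M[R]_(p, q) -> R)
    (M : 'M[R]_(p, q)) : 'M[R]_(p, q) :=
  \matrix_(i, j) 'D_(delta_mx i j) (f : 'M[R]_(p, q) -> R^o) M.

Section SymmetricMatrices.
Variables (R : realType) (n : nat).

Definition symx_pred : {pred 'M[R]_n} := fun M => M \is symmetricmx.

Fact symx_predE M : (M \in symx_pred) = (M == M^T).
Proof.
rewrite [LHS](is_hermitianmxE false (@idfun R) M) expr0 scale1r.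
by rewrite map_mx_id.
Qed.

Fact symx_submod_closed : submod_closed symx_pred.
Proof.
split=> [|a M N]; rewrite !symx_predE.
  by rewrite trmx0.
by move=> /eqP hM /eqP hN; rewrite linearD linearZ /= -hM -hN.
Qed.

HB.instance Definition _ :=
  GRing.isSubmodClosed.Build R 'M[R]_n symx_pred symx_submod_closed.

Record symx : Type :=
  Symx { mx_of_symx :> 'M[R]_n ; _ : symx_pred mx_of_symx }.

HB.instance Definition _ := [isSub for mx_of_symx].
HB.instance Definition _ := [Choice of symx by <:].
HB.instance Definition _ := [SubChoice_isSubLmodule of symx by <:].

Definition psd : set symx :=
  [set X | forall v : 'cV[R]_n, 0 <= (v^T *m X *m v) 0 0].

Fact gram_subproof k (F : 'M[R]_(n, k)) : symx_pred (F *m F^T).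
Proof.
by have := symx_predE (F *m F^T); rewrite trmx_mul trmxK eqxx.
Qed.

Definition gram k (F : 'M[R]_(n, k)) : symx := Symx (gram_subproof F).

Definition factors k (X : symx) : set 'M[R]_(n, k) := [set F | gram F = X].

End SymmetricMatrices.

Definition is_adjoint (R : realType) (n m : nat)
    (A : {linear symx R n -> 'cV[R]_m}) (Aadj : 'cV[R]_m -> symx R n) : Prop :=
  forall (X : symx R n) (y : 'cV[R]_m), mxdot (A X) y = mxdot X (Aadj y).

Section SDP.
Variables (R : realType) (n m : nat).
Variables (A : {linear symx R n -> 'cV[R]_m}) (Aadj : 'cV[R]_m -> symx R n).
Variables (C : symx R n) (b : 'cV[R]_m).

Definition slack (y : 'cV[R]_m) : symx R n := C - Aadj y.

Definition primal_solutions : set (symx R n) :=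
  argmin [set X | A X = b /\ psd X] (fun X : symx R n => mxdot C X).

Definition dual_solutions : set 'cV[R]_m :=
  argmax [set y | psd (slack y)] (fun y => mxdot b y).

Definition optimal_pair (X : symx R n) (y : 'cV[R]_m) : Prop :=
  primal_solutions X /\ dual_solutions y.

Definition strong_duality : Prop :=
  (exists X y, optimal_pair X y) /\
  (forall X y, optimal_pair X y -> mxdot C X = mxdot b y).

Definition strictly_complementary (X : symx R n) (y : 'cV[R]_m) : Prop :=
  optimal_pair X y /\ (\rank X + \rank (slack y))%N = n.

Definition primal_simple : Prop :=
  [/\ strong_duality,
      (exists X y, strictly_complementary X y)
    & exists X, primal_solutions = [set X]].

Definition lagrangian (rho : R) (X : symx R n) (y : 'cV[R]_m) : R :=
  mxdot C X + mxdot y (b - A X) + rho / 2 * mxnormF (A X - b) ^+ 2.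

Definition alp_solutions (rho : R) (y : 'cV[R]_m) : set (symx R n) :=
  argmin (@psd R n) (fun X => lagrangian rho X y).

Definition bm_lagrangian (rho : R) (k : nat) (F : 'M[R]_(n, k))
    (y : 'cV[R]_m) : R :=
  lagrangian rho (gram F) y.

(* F 0 is unconstrained: the iteration starts at index 1. *)
Definition is_gradient_descent (rho eta : R) (k : nat) (y : 'cV[R]_m)
    (F : nat -> 'M[R]_(n, k)) : Prop :=
  forall t : nat, (1 <= t)%N ->
    F t.+1 = F t - eta *: gradient (fun G => bm_lagrangian rho G y) (F t).

End SDP.

Definition nearest_points (R : realType) (p q : nat) (S : set 'M[R]_(p, q))
    (F : 'M[R]_(p, q)) : set 'M[R]_(p, q) :=
  argmin S (fun G => mxnormF (F - G)).

(* Main.v *)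
(** With [d := (y - ystar) / rho], completing the square turns the augmented
  Lagrangian into [<Z, X> + rho/2 |A X - b - d|^2] plus a constant, where
  [Z = Z(ystar)]; so [y] close to [ystar] is a small perturbation [d] of the
  data.  At [d = 0] and [F F^T = Xstar], strict complementarity
  ([ker Z = range F]) and primal uniqueness ([A] is injective on the matrices
  [F E F^T]) make three quadratic forms positive definite: the Hessian of the
  factored objective on the directions orthogonal to the orbit [F O(k)], the
  slack matrix on the orthogonal of [range F], and [E |-> |A (F E F^T)|^2].
  By compactness their positivity survives, with a uniform constant, for every
  factor of a matrix near [Xstar], every small [d] and every small
  displacement.

  A minimizer of the factored objective over a large ball is then interior,
  hence stationary, and stability of the last two forms makes it the unique
  solution of (AL-P).  For the iteration, the nearest factor [F0] to [F] is a
  Procrustes minimizer, so [F0^T F] is symmetric positive semidefinite; hence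
  [F - F0] is orthogonal to the orbit, the gradient [G] satisfies
  [<G, F - F0> >= tau |F - F0|^2] and [|G|^2 <= L |F - F0|^2], and a step of
  size [eta < tau / L] contracts [|F - F0|^2] by [1 - eta tau]. *)

Require Import Defs.
From mathcomp Require Import all_boot all_order all_algebra.
From mathcomp Require Import all_classical all_reals all_analysis.
From mathcomp Require Import ring lra.

Set Implicit Arguments.
Unset Strict Implicit.
Unset Printing Implicit Defensive.
Import Order.TTheory GRing.Theory Num.Theory.
Import numFieldNormedType.Exports.
Local Open Scope classical_set_scope.
Local Open Scope ring_scope.

(** * Frobenius inner product, continuity and compactness *)

Section FrobeniusProduct.
Variable R : realType.

Definition nsq p q (M : 'M[R]_(p, q)) : R := mxdot M M.

Lemma mxdotE p q (M N : 'M[R]_(p, q)) :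
  mxdot M N = \sum_j \sum_i M i j * N i j.
Proof.
rewrite /mxdot /mxtrace; apply: eq_bigr => j _.
by rewrite mxE; apply: eq_bigr => i _; rewrite mxE.
Qed.

Lemma mxdotC p q (M N : 'M[R]_(p, q)) : mxdot M N = mxdot N M.
Proof. by rewrite /mxdot -mxtrace_tr trmx_mul trmxK. Qed.

Lemma mxdotDl p q (M M' N : 'M[R]_(p, q)) :
  mxdot (M + M') N = mxdot M N + mxdot M' N.
Proof. by rewrite /mxdot linearD mulmxDl mxtraceD. Qed.

Lemma mxdotZl p q (a : R) (M N : 'M[R]_(p, q)) :
  mxdot (a *: M) N = a * mxdot M N.
Proof. by rewrite /mxdot linearZ /= -scalemxAl mxtraceZ. Qed.

Lemma mxdotDr p q (M N N' : 'M[R]_(p, q)) :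
  mxdot M (N + N') = mxdot M N + mxdot M N'.
Proof. by rewrite mxdotC mxdotDl !(mxdotC M). Qed.

Lemma mxdotZr p q (a : R) (M N : 'M[R]_(p, q)) :
  mxdot M (a *: N) = a * mxdot M N.
Proof. by rewrite mxdotC mxdotZl mxdotC. Qed.

Lemma mxdotNl p q (M N : 'M[R]_(p, q)) : mxdot (- M) N = - mxdot M N.
Proof. by rewrite -scaleN1r mxdotZl mulN1r. Qed.

Lemma mxdotNr p q (M N : 'M[R]_(p, q)) : mxdot M (- N) = - mxdot M N.
Proof. by rewrite mxdotC mxdotNl mxdotC. Qed.

Lemma mxdotBl p q (M M' N : 'M[R]_(p, q)) :
  mxdot (M - M') N = mxdot M N - mxdot M' N.
Proof. by rewrite mxdotDl mxdotNl. Qed.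

Lemma mxdotBr p q (M N N' : 'M[R]_(p, q)) :
  mxdot M (N - N') = mxdot M N - mxdot M N'.
Proof. by rewrite mxdotDr mxdotNr. Qed.

Lemma mxdot0l p q (N : 'M[R]_(p, q)) : mxdot 0 N = 0.
Proof. by rewrite -(scale0r 0) mxdotZl mul0r. Qed.

Lemma mxdot0r p q (N : 'M[R]_(p, q)) : mxdot N 0 = 0.
Proof. by rewrite mxdotC mxdot0l. Qed.

Lemma mxdot_suml p q (I : finType) (G : I -> 'M[R]_(p, q)) (N : 'M[R]_(p, q)) :
  mxdot (\sum_i G i) N = \sum_i mxdot (G i) N.
Proof.
by elim/big_rec2: _ => [|i x M _ <-]; rewrite ?mxdot0l ?mxdotDl.
Qed.

Lemma mxdot_trmx p q (M N : 'M[R]_(p, q)) : mxdot M^T N^T = mxdot M N.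
Proof. by rewrite /mxdot trmxK mxtrace_mulC -mxtrace_tr trmx_mul trmxK. Qed.

Lemma mxdot_mull p q s (A : 'M[R]_(p, q)) (M : 'M[R]_(q, s)) (N : 'M[R]_(p, s)) :
  mxdot (A *m M) N = mxdot M (A^T *m N).
Proof. by rewrite /mxdot trmx_mul mulmxA. Qed.

Lemma mxdot_mulr p q s (A : 'M[R]_(q, s)) (M : 'M[R]_(p, q)) (N : 'M[R]_(p, s)) :
  mxdot (M *m A) N = mxdot M (N *m A^T).
Proof. by rewrite -mxdot_trmx trmx_mul mxdot_mull trmxK -mxdot_trmx trmx_mul !trmxK. Qed.

Lemma mxdot_cV p (u v : 'cV[R]_p) : mxdot u v = (u^T *m v) 0 0.
Proof. by rewrite /mxdot /mxtrace big_ord1. Qed.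

Lemma nsq_ge0 p q (M : 'M[R]_(p, q)) : 0 <= nsq M.
Proof.
rewrite /nsq mxdotE; apply: sumr_ge0 => j _; apply: sumr_ge0 => i _.
by rewrite -expr2 sqr_ge0.
Qed.

Lemma sqr_entry_le_nsq p q (M : 'M[R]_(p, q)) i j : M i j ^+ 2 <= nsq M.
Proof.
rewrite /nsq mxdotE (bigD1 j) //= (bigD1 i) //= expr2 -addrA lerDl.
by apply: addr_ge0; apply: sumr_ge0 => ? _; last (apply: sumr_ge0 => ? _);
   rewrite -expr2 sqr_ge0.
Qed.

Lemma nsq_eq0 p q (M : 'M[R]_(p, q)) : nsq M = 0 -> M = 0.
Proof.
move=> M0; apply/matrixP => i j; rewrite mxE; apply/eqP.
by rewrite -sqrf_eq0 eq_le sqr_ge0 andbT -M0 sqr_entry_le_nsq.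
Qed.

Lemma nsq_gt0 p q (M : 'M[R]_(p, q)) : M != 0 -> 0 < nsq M.
Proof.
by move=> M0; rewrite lt_neqAle nsq_ge0 andbT eq_sym; apply: contraNneq M0 => /nsq_eq0 ->.
Qed.

Lemma nsqZ p q a (M : 'M[R]_(p, q)) : nsq (a *: M) = a ^+ 2 * nsq M.
Proof. by rewrite /nsq mxdotZl mxdotZr mulrA. Qed.

Lemma nsqN p q (M : 'M[R]_(p, q)) : nsq (- M) = nsq M.
Proof. by rewrite /nsq mxdotNl mxdotNr opprK. Qed.

Lemma nsqD p q (M N : 'M[R]_(p, q)) :
  nsq (M + N) = nsq M + 2 * mxdot M N + nsq N.
Proof. by rewrite /nsq mxdotDl !mxdotDr (mxdotC N); ring. Qed.

Lemma nsqB p q (M N : 'M[R]_(p, q)) :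
  nsq (M - N) = nsq M - 2 * mxdot M N + nsq N.
Proof. by rewrite nsqD nsqN mxdotNr; ring. Qed.

Lemma mxnormF_sqr p q (M : 'M[R]_(p, q)) : mxnormF M ^+ 2 = nsq M.
Proof. by rewrite sqr_sqrtr // nsq_ge0. Qed.

Lemma mul_tr_eq0 p q (M : 'M[R]_(p, q)) : M *m M^T = 0 -> M = 0.
Proof.
move=> h; rewrite -(trmxK M); suff -> : M^T = 0 by rewrite trmx0.
by apply: nsq_eq0; rewrite /nsq /mxdot trmxK h mxtrace0.
Qed.

End FrobeniusProduct.

Section MatrixContinuity.
Variable R : realType.
Variable T : topologicalType.

Lemma cont_mx p q (f : T -> 'M[R]_(p, q)) :
  (forall i j, continuous (fun x => f x i j : R)) -> continuous f.
Proof.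
move=> h x; apply/cvg_ballP => e e0.
have H : \forall y \near x, forall i j, ball (f x i j) e (f y i j).
  apply: filter_forall => i; apply: filter_forall => j.
  by have /cvg_ballP/(_ _ e0) := h i j x.
by apply: filterS H => y hy; split.
Qed.

Lemma cont_entry p q (f : T -> 'M[R]_(p, q)) i j :
  continuous f -> continuous (fun x => f x i j : R).
Proof. by move=> cf x; exact: (cvg_comp _ _ (cf x) (@coord_continuous R p q i j (f x))). Qed.

Lemma cont_add p q (f g : T -> 'M[R]_(p, q)) :
  continuous f -> continuous g -> continuous (fun x => f x + g x).
Proof. by move=> cf cg x; apply: cvgD; [exact: cf|exact: cg]. Qed.

Lemma cont_opp p q (f : T -> 'M[R]_(p, q)) :
  continuous f -> continuous (fun x => - f x).
Proof. by move=> cf x; apply: cvgN; exact: cf. Qed.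

Lemma cont_radd (f g : T -> R) :
  continuous f -> continuous g -> continuous (fun x => f x + g x).
Proof. by move=> cf cg x; apply: cvgD; [exact: cf|exact: cg]. Qed.

Lemma cont_ropp (f : T -> R) : continuous f -> continuous (fun x => - f x).
Proof. by move=> cf x; apply: cvgN; exact: cf. Qed.

Lemma cont_rmul (f g : T -> R) :
  continuous f -> continuous g -> continuous (fun x => f x * g x).
Proof. by move=> cf cg x; apply: cvgM; [exact: cf|exact: cg]. Qed.

Lemma cont_cst (V : topologicalType) (a : V) : continuous (fun _ : T => a).
Proof. by move=> x; exact: cvg_cst. Qed.

Lemma cont_rsum (I : finType) (f : I -> T -> R) :
  (forall i, continuous (f i)) -> continuous (fun x => \sum_i f i x).
Proof.
move=> cf x.
by apply: cvg_big => [|i _]; [exact: add_continuous|exact: cf].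
Qed.

Lemma cont_tr p q (f : T -> 'M[R]_(p, q)) :
  continuous f -> continuous (fun x => (f x)^T).
Proof.
move=> cf; apply: cont_mx => i j.
under eq_fun do rewrite mxE.
exact: cont_entry.
Qed.

Lemma cont_mul p q s (f : T -> 'M[R]_(p, q)) (g : T -> 'M[R]_(q, s)) :
  continuous f -> continuous g -> continuous (fun x => f x *m g x).
Proof.
move=> cf cg; apply: cont_mx => i j.
under eq_fun do rewrite mxE.
by apply: cont_rsum => k; apply: cont_rmul; exact: cont_entry.
Qed.

Lemma cont_scale p q (a : T -> R) (f : T -> 'M[R]_(p, q)) :
  continuous a -> continuous f -> continuous (fun x => a x *: f x).
Proof. by move=> ca cf x; apply: cvgZ; [exact: ca|exact: cf]. Qed.

Lemma cont_mxdot p q (f g : T -> 'M[R]_(p, q)) :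
  continuous f -> continuous g -> continuous (fun x => mxdot (f x) (g x)).
Proof.
move=> cf cg; under eq_fun do rewrite mxdotE.
apply: cont_rsum => j; apply: cont_rsum => i.
by apply: cont_rmul; exact: cont_entry.
Qed.

Lemma cont_nsq p q (f : T -> 'M[R]_(p, q)) :
  continuous f -> continuous (fun x => nsq (f x)).
Proof. by move=> cf; exact: cont_mxdot. Qed.

End MatrixContinuity.

(** * Compactness and uniform positivity *)

Section Compactness.
Variable R : realType.

Lemma closed_le_fun (T : topologicalType) (f g : T -> R) :
  continuous f -> continuous g -> closed [set x | f x <= g x].
Proof.
move=> cf cg; rewrite (_ : [set x | _] = (fun x => g x - f x) @^-1` [set r | 0 <= r]).
  apply: (continuous_closedP _).1; last exact: closed_ge.
  by apply: cont_radd => //; exact: cont_ropp.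
by apply/seteqP; split => x /=; rewrite subr_ge0.
Qed.

Lemma closed_eq_fun (T : topologicalType) (f g : T -> R) :
  continuous f -> continuous g -> closed [set x | f x = g x].
Proof.
move=> cf cg.
rewrite (_ : [set x | _] = [set x | f x <= g x] `&` [set x | g x <= f x]).
  by apply: closedI; exact: closed_le_fun.
apply/seteqP; split => x /= => [->//|[h1 h2]].
by apply/eqP; rewrite eq_le h1.
Qed.

Lemma cont_id (T : topologicalType) : continuous (fun x : T => x).
Proof. by move=> x; exact: cvg_id. Qed.

Lemma cont_fst (S T U : topologicalType) (f : S -> T * U) :
  continuous f -> continuous (fun x => (f x).1).
Proof.
move=> cf x; apply: (@cvg_comp _ _ _ f fst _ (nbhs (f x)) _ (cf x)).
by case: (f x) => a b; exact: (@cvg_fst _ _ (nbhs a) (nbhs b)).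
Qed.

Lemma cont_snd (S T U : topologicalType) (f : S -> T * U) :
  continuous f -> continuous (fun x => (f x).2).
Proof.
move=> cf x; apply: (@cvg_comp _ _ _ f snd _ (nbhs (f x)) _ (cf x)).
by case: (f x) => a b; exact: (@cvg_snd _ _ (nbhs a) (nbhs b)).
Qed.

Lemma compact_nsq_ball p q (B : R) : compact [set M : 'M[R]_(p, q) | nsq M <= B].
Proof.
have [B0|B0] := leP 0 B; last first.
  rewrite (_ : [set M | _] = set0); first exact: compact0.
  apply/seteqP; split=> // M /= h; have := nsq_ge0 M; lra.
pose K := [set v : 'rV[R]_(p * q) | nsq (vec_mx v : 'M[R]_(p, q)) <= B].
have cvec : continuous (fun v : 'rV[R]_(p * q) => vec_mx v : 'M[R]_(p, q)).
  apply: cont_mx => i j.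
  under eq_fun do rewrite mxE.
  by apply: cont_entry; exact: cont_id.
have cK : compact K.
  apply: bounded_closed_compact; last first.
    by apply: closed_le_fun; [exact: cont_nsq|exact: cont_cst].
  exists (Num.sqrt B); split; first exact: num_real.
  move=> x hx v /= hv; apply: le_trans (ltW hx).
  rewrite [leLHS]/Num.Def.normr /= mx_normrE; apply/bigmax_leP; split; first exact: sqrtr_ge0.
  move=> [i l] _ /=; case/mxvec_indexP: l => a b.
  rewrite -sqrtr_sqr ler_sqrt ?(ord1 i) //.
  apply: le_trans hv; apply: le_trans (sqr_entry_le_nsq _ a b).
  by rewrite mxE.
rewrite (_ : [set M | _] = (fun v => vec_mx v : 'M[R]_(p, q)) @` K).
  by apply: continuous_compact cK => //; apply: continuous_subspaceT.
apply/seteqP; split => M /=.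
  by move=> h; exists (mxvec M); rewrite /K /= ?mxvecK.
by case=> v hv <-.
Qed.

Lemma EVT_le (T : topologicalType) (K : set T) (f : T -> R) :
  compact K -> K !=set0 -> continuous f ->
  exists2 x, K x & forall y, K y -> f x <= f y.
Proof.
move=> cK K0 cf; have [x xK h] := compact_EVT_min K0 cK (continuous_subspaceT cf).
by exists x => [|y Ky]; [exact: set_mem|apply: h; exact: mem_set].
Qed.

(* The extreme value theorem for [max f g], which is positive on [K]. *)
Lemma compact_stab (T : topologicalType) (K : set T) (f g : T -> R) :
  compact K -> continuous f -> continuous g ->
  (forall x, K x -> f x <= 0 -> 0 < g x) ->
  exists2 tau, 0 < tau & forall x, K x -> f x <= tau -> tau <= g x.
Proof.
move=> cK cf cg h.
have [K0|/set0P/negP/negPn/eqP K0] := pselect (K !=set0); last first.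
  by exists 1 => // x; rewrite K0.
have cfg : continuous (fun x => Num.max (f x) (g x)).
  exact: (max_fun_continuous cf cg).
have [x Kx hx] := EVT_le cK K0 cfg.
have pos : 0 < Num.max (f x) (g x).
  by rewrite lt_max; case: (ltP 0 (f x)) => //= fx; exact: h.
exists (Num.max (f x) (g x) / 2); first lra.
move=> y Ky fy; have := hx y Ky; rewrite le_max.
case/orP => hy; lra.
Qed.

Lemma compact_nsq_sphere p q : compact [set D : 'M[R]_(p, q) | nsq D = 1].
Proof.
rewrite (_ : [set D | _] = [set D | nsq D <= 1] `&` [set D | nsq D = 1]).
  apply: compact_closedI; first exact: compact_nsq_ball.
  by apply: closed_eq_fun; [apply: cont_nsq; exact: cont_id|exact: cont_cst].
by apply/seteqP; split => D /= => [->|[]].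
Qed.

Lemma hom_normalize p q (g : 'M[R]_(p, q) -> R) D :
  (forall a D, g (a *: D) = a ^+ 2 * g D) -> D != 0 ->
  exists2 D1, nsq D1 = 1 & g D = nsq D * g D1.
Proof.
move=> hom /nsq_gt0 D1; pose s := Num.sqrt (nsq D).
have s0 : s != 0 by rewrite gt_eqF // sqrtr_gt0.
have sE : s ^+ 2 = nsq D by rewrite sqr_sqrtr // ltW.
exists (s^-1 *: D); first by rewrite nsqZ -sE exprVn mulVf // expf_neq0.
by rewrite -sE -hom scalerA mulfV // scale1r.
Qed.

(** [compact_stab] on the product of [K] with the unit sphere gives the margin there, and
    homogeneity of degree two spreads it to all [D]. In its uses [f] measures the distance to the
    optimal set. *)
Lemma hom_stab (T : topologicalType) p q (K : set T) (f : T -> R)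
    (g : T * 'M[R]_(p, q) -> R) :
  compact K -> continuous f -> continuous g ->
  (forall x a D, g (x, a *: D) = a ^+ 2 * g (x, D)) ->
  (forall x D, K x -> f x <= 0 -> D != 0 -> 0 < g (x, D)) ->
  exists2 tau, 0 < tau &
    forall x D, K x -> f x <= tau -> tau * nsq D <= g (x, D).
Proof.
move=> cK cf cg hom pos.
have cf1 : continuous (fun x : T * 'M[R]_(p, q) => f x.1).
  by move=> [x D]; exact: (@cvg_comp _ _ _ fst f _ (nbhs x) _ cvg_fst (cf x)).
have [|tau tau0 h] := compact_stab (compact_setX cK (@compact_nsq_sphere p q)) cf1 cg.
  move=> [x D] [/= Kx D1] fx; apply: pos => //.
  by apply: contra_eq_neq D1 => ->; rewrite /nsq mxdot0l eq_sym oner_eq0.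
exists tau => // x D Kx fx.
have [->|D0] := eqVneq D 0.
  by rewrite -{2}(scale0r 0) hom /nsq mxdot0l mulr0 expr0n mul0r.
have [D1 D1E ->] := hom_normalize (hom x) D0.
by rewrite mulrC ler_pM2l ?nsq_gt0 //; exact: h.
Qed.

Lemma hom_bound (T : topologicalType) p q (K : set T) (g : T * 'M[R]_(p, q) -> R) :
  compact K -> continuous g ->
  (forall x a D, g (x, a *: D) = a ^+ 2 * g (x, D)) ->
  exists2 L, 0 < L & forall x D, K x -> g (x, D) <= L * nsq D.
Proof.
move=> cK cg hom.
pose S := K `*` [set D : 'M[R]_(p, q) | nsq D = 1].
have cS : compact S := compact_setX cK (@compact_nsq_sphere p q).
have [L L0 hL] : exists2 L, 0 < L & forall x, S x -> g x <= L.
  have [S0|/set0P/negP/negPn/eqP S0] := pselect (S !=set0); last first.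
    by exists 1 => // x; rewrite S0.
  have [x Sx hx] := EVT_le cS S0 (cont_ropp cg).
  exists (Num.max (g x) 1); first by rewrite lt_max ltr01 orbT.
  by move=> y Sy; rewrite le_max -lerN2 hx.
exists L => // x D Kx.
have [->|D0] := eqVneq D 0.
  by rewrite -{1}(scale0r 0) hom /nsq mxdot0l mulr0 expr0n mul0r.
have [D1 D1E ->] := hom_normalize (hom x) D0.
by rewrite mulrC ler_pM2r ?nsq_gt0 //; exact: hL.
Qed.

End Compactness.

(** * Positive semidefinite matrices and the Procrustes problem *)

Section PSD.
Variable R : realType.

(** The test point [t = - a s] gives [a^2 s (b s - 1)], negative for small [s > 0] unless [a = 0].
    This is the first-order condition behind the perturbation arguments below. *)
Lemma quad_ge0_lin0 (a b t0 : R) : 0 < t0 ->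
  (forall t, `|t| <= t0 -> 0 <= a * t + b * t ^+ 2) -> a = 0.
Proof.
move=> t0p h; apply/eqP; apply: contraT => a0.
have ap : 0 < `|a| by rewrite normr_gt0.
have bp := normr_ge0 b.
(* This makes [s = t0 / d] satisfy both [s |a| <= t0], so that the test point is admissible, and
   [2 (|b| + 1) s <= 1], so that [b s < 1]. *)
pose d := `|a| + 2 * t0 * (`|b| + 1).
have dp : 0 < d by rewrite /d; nra.
pose s := t0 / d.
have sp : 0 < s by rewrite divr_gt0.
have sd : s * d = t0 by rewrite divfK // gt_eqF.
have stb : 0 <= s * t0 * (`|b| + 1) by apply: mulr_ge0; [apply: mulr_ge0; exact: ltW|exact: addr_ge0].
have sa : 0 <= s * `|a| by apply: mulr_ge0 => //; exact: ltW.
have := h (- (a * s)); rewrite normrN normrM (gtr0_norm sp).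
have -> : `|a| * s <= t0 by rewrite -sd /d; lra.
move=> /(_ isT).
have -> : a * - (a * s) + b * (- (a * s)) ^+ 2 = a ^+ 2 * s * (b * s - 1) by ring.
have a2 : 0 < a ^+ 2 by rewrite exprn_even_gt0.
rewrite (pmulr_rge0 _ (mulr_gt0 a2 sp)) => hbs.
have hb := ler_norm b.
have : t0 * (2 * (`|b| + 1) * s) <= t0 * 1 by rewrite mulr1 -{2}sd /d; lra.
rewrite ler_pM2l // => ?; nra.
Qed.

Lemma trB p q (M N : 'M[R]_(p, q)) : (M - N)^T = M^T - N^T.
Proof. exact: linearB. Qed.

Lemma trZ p q a (M : 'M[R]_(p, q)) : (a *: M)^T = a *: M^T.
Proof. exact: linearZ. Qed.

Lemma trD p q (M N : 'M[R]_(p, q)) : (M + N)^T = M^T + N^T.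
Proof. exact: linearD. Qed.

Definition psdmx n (X : 'M[R]_n) : Prop :=
  X^T = X /\ forall v : 'cV[R]_n, 0 <= mxdot v (X *m v).

Lemma mxdot_cols p q (M N : 'M[R]_(p, q)) :
  mxdot M N = \sum_j mxdot (col j M) (col j N).
Proof.
rewrite mxdotE; apply: eq_bigr => j _; rewrite mxdotE big_ord1.
by apply: eq_bigr => i _; rewrite !mxE.
Qed.

Lemma col_mulmx p q s (M : 'M[R]_(p, q)) (N : 'M[R]_(q, s)) j :
  col j (M *m N) = M *m col j N.
Proof. by rewrite !colE mulmxA. Qed.

Lemma psdmx_ker n (X : 'M[R]_n) (v : 'cV[R]_n) :
  psdmx X -> mxdot v (X *m v) = 0 -> X *m v = 0.
Proof.
move=> [Xs Xp] v0; set w := X *m v.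
suff : 2 * nsq w = 0 by move=> /eqP; rewrite mulf_eq0 pnatr_eq0 /= => /eqP /nsq_eq0.
apply: (@quad_ge0_lin0 _ (mxdot w (X *m w)) 1) => // t _.
have := Xp (v + t *: w).
rewrite mulmxDr -scalemxAr mxdotDl !mxdotDr !mxdotZl !mxdotZr v0.
have -> : mxdot v (X *m w) = nsq w by rewrite -{1}Xs -mxdot_mull.
by rewrite -/w /nsq; congr (0 <= _); ring.
Qed.

Lemma psdmx_mxdot_ge0 n q (X : 'M[R]_n) (G : 'M[R]_(n, q)) :
  psdmx X -> 0 <= mxdot G (X *m G).
Proof.
move=> [_ Xp]; rewrite mxdot_cols; apply: sumr_ge0 => j _.
by rewrite col_mulmx.
Qed.

Lemma psdmx_mxdot_eq0 n q (X : 'M[R]_n) (G : 'M[R]_(n, q)) :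
  psdmx X -> mxdot G (X *m G) = 0 -> X *m G = 0.
Proof.
move=> pX /eqP; rewrite mxdot_cols psumr_eq0; last first.
  by move=> j _; rewrite col_mulmx; case: pX.
move=> /allP h; apply/matrixP => i j; rewrite [RHS]mxE.
have /eqP := h j (mem_index_enum _); rewrite col_mulmx => /(psdmx_ker pX).
by rewrite -col_mulmx => /matrixP/(_ i 0); rewrite !mxE.
Qed.

Lemma mxdot_gram n q (X : 'M[R]_n) (G : 'M[R]_(n, q)) :
  mxdot X (G *m G^T) = mxdot G (X *m G).
Proof. by rewrite [RHS]mxdotC mxdot_mulr. Qed.

Lemma psdmx_gram n q (G : 'M[R]_(n, q)) : psdmx (G *m G^T).
Proof.
split=> [|v]; first by rewrite trmx_mul trmxK.
by rewrite -mulmxA -{1}(trmxK G) -mxdot_mull; exact: nsq_ge0.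
Qed.

(* [|F D^T|^2 = - <F D^T, D F^T> = - |F^T D|^2 <= 0] *)
Lemma antisym_sym_eq0 n k (F D : 'M[R]_(n, k)) :
  (forall M : 'M[R]_(k, n), F *m M = 0 -> M = 0) ->
  F *m D^T + D *m F^T = 0 -> F^T *m D = D^T *m F -> D = 0.
Proof.
move=> inj anti sym; rewrite -(trmxK D); apply/eqP; rewrite trmx_eq0; apply/eqP.
apply: inj; apply: nsq_eq0; apply: le_anti; rewrite nsq_ge0 andbT.
have e : mxdot (F *m D^T) (D *m F^T) = nsq (F^T *m D).
  by rewrite mxdot_mull mulmxA -mxdot_mulr -sym.
have e1 : D *m F^T = - (F *m D^T) by apply/eqP; rewrite -addr_eq0 addrC anti.
by rewrite -oppr_ge0 /nsq -mxdotNr -e1 e nsq_ge0.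
Qed.

(* Apply [antisym_sym_eq0] to [F + F0] and [F - F0]. *)
Lemma gram_inj_psd n k (F F0 : 'M[R]_(n, k)) :
  row_full F0 -> F *m F^T = F0 *m F0^T -> psdmx (F0^T *m F) -> F = F0.
Proof.
move=> /row_fullP[B BF] FF pN.
have [Ns _] := pN; rewrite trmx_mul trmxK in Ns.
apply/eqP; rewrite -subr_eq0; apply/eqP.
apply: (@antisym_sym_eq0 _ _ (F + F0)).
- move=> M hM.
  suff : F0 *m M = 0 by move=> h; rewrite -(mul1mx M) -BF -mulmxA h mulmx0.
  have := nsqD (F *m M) (F0 *m M); rewrite -mulmxDl hM.
  rewrite {1}/nsq mxdot0l => h; apply: nsq_eq0.
  have := psdmx_mxdot_ge0 M pN; rewrite -mulmxA -mxdot_mull mxdotC.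
  by have := nsq_ge0 (F *m M); have := nsq_ge0 (F0 *m M); lra.
- rewrite trB trD !mulmxDl !mulmxDr !mulmxN !mulNmx FF.
  apply/matrixP => i j; rewrite !mxE; ring.
- rewrite trB trD !mulmxDl !mulmxDr !mulmxN !mulNmx Ns.
  apply/matrixP => i j; rewrite !mxE; ring.
Qed.

Lemma mxdot_col_mx p1 p2 q (M M' : 'M[R]_(p1, q)) (N N' : 'M[R]_(p2, q)) :
  mxdot (col_mx M N) (col_mx M' N') = mxdot M M' + mxdot N N'.
Proof. by rewrite /mxdot tr_col_mx mul_row_col mxtraceD. Qed.

(** * Procrustes maximizers and nearest factors *)

Section Nearest.
Variables (k : nat) (N : 'M[R]_k).
Hypothesis maxN : forall U : 'M[R]_k, U *m U^T = 1%:M -> mxdot N U <= mxdot N 1%:M.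

(* [1] for [v = 0], since division by [0] gives [0]. *)
Definition householder (v : 'cV[R]_k) : 'M[R]_k := 1%:M - (2 / nsq v) *: (v *m v^T).

Lemma householder_mul v w :
  householder v *m householder w = 1%:M - (2 / nsq v) *: (v *m v^T)
    - (2 / nsq w) *: (w *m w^T)
    + (2 / nsq v * (2 / nsq w) * mxdot v w) *: (v *m w^T).
Proof.
have e : v *m v^T *m (w *m w^T) = mxdot v w *: (v *m w^T).
  rewrite -mulmxA (mulmxA v^T) (mx11_scalar (v^T *m w)) -mxdot_cV.
  by rewrite mul_scalar_mx scalemxAr.
rewrite /householder mulmxBl mul1mx mulmxBr mulmx1 -scalemxAl -scalemxAr e.
apply/matrixP => i j; rewrite !mxE; ring.
Qed.

Lemma householder_tr v : (householder v)^T = householder v.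
Proof. by rewrite /householder trB trZ trmx1 trmx_mul trmxK. Qed.

Lemma householder_orth v : v != 0 -> householder v *m (householder v)^T = 1%:M.
Proof.
move=> v0; rewrite householder_tr householder_mul -/(nsq v).
have := nsq_gt0 v0 => h; apply/matrixP => i j; rewrite !mxE.
by field; rewrite gt_eqF.
Qed.

(* Positivity: test [maxN] on a reflection. Symmetry: test it on the product of
   the reflections in [e_i] and [e_i + t e_j], to first order in [t]. *)
Lemma procrustes_psd : psdmx N.
Proof.
have sym i j : N i j = N j i.
  have [->//|ij] := eqVneq i j.
  suff : N j i - N i j = 0 by move=> /eqP; rewrite subr_eq0 => /eqP.
  apply: (@quad_ge0_lin0 (N j i - N i j) (N i i + N j j) 1) => // t _.
  pose v : 'cV[R]_k := delta_mx i 0; pose w : 'cV[R]_k := v + t *: delta_mx j 0.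
  have ip a b : mxdot (delta_mx a 0 : 'cV[R]_k) (delta_mx b 0) = (a == b)%:R.
    by rewrite mxdot_cV trmx_delta mul_delta_mx_cond; case: eqP; rewrite ?mulr1n ?mulr0n mxE.
  have Nd a b : mxdot N ((delta_mx a 0 : 'cV[R]_k) *m (delta_mx b 0)^T) = N a b.
    rewrite trmx_delta mul_delta_mx mxdotE (bigD1 b) //= (bigD1 a) //= !mxE !eqxx mulr1.
    rewrite big1 => [|l la]; last by rewrite mxE (negPf la) mulr0.
    rewrite big1 => [|l la]; first by rewrite !addr0.
    by rewrite big1 // => s _; rewrite mxE (negPf la) andbF mulr0.
  have nv : nsq v = 1 by rewrite /nsq ip eqxx.
  have nw : nsq w = 1 + t ^+ 2.
    by rewrite nsqD nv nsqZ mxdotZr /nsq !ip eqxx (negPf ij) /=; ring.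
  have vw : mxdot v w = 1 by rewrite mxdotDr mxdotZr !ip eqxx (negPf ij) /=; ring.
  have v0 : v != 0 by apply: contra_eq_neq nv => ->; rewrite /nsq mxdot0l eq_sym oner_eq0.
  have pw : 0 < nsq w by rewrite nw; nra.
  have w0 : w != 0 by apply: contraTneq pw => ->; rewrite /nsq mxdot0l ltxx.
  have := @maxN (householder v *m householder w).
  rewrite trmx_mul -mulmxA (mulmxA (householder w)) householder_orth // mul1mx.
  rewrite householder_orth // => /(_ erefl).
  rewrite householder_mul mxdotDr !mxdotBr !mxdotZr vw nv nw.
  rewrite /w trD trZ !mulmxDl !mulmxDr. rewrite -!scalemxAl -!scalemxAr.
  rewrite !mxdotDr !mxdotZr !Nd.
  have t2 : 0 < 1 + t ^+ 2 by rewrite -nw.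
  set c := 2 / (1 + t ^+ 2).
  have c0 : 0 < c by rewrite divr_gt0.
  have ct : c * (1 + t ^+ 2) = 2 by rewrite divfK // gt_eqF.
  move=> h.
  have : 0 <= c * ((1 + t ^+ 2) * N i i + (N i i + t * N i j + (t * N j i + t * (t * N j j))) - 2 * (N i i + t * N i j)).
    rewrite mulrBr mulrDr (mulrA c (1 + t ^+ 2)) ct; lra.
  rewrite pmulr_rge0 //; lra.
split=> [|v]; first by apply/matrixP => i j; rewrite mxE sym.
have [->|v0] := eqVneq v 0; first by rewrite mulmx0 mxdot0r.
have := maxN (householder_orth v0).
rewrite /householder mxdotBr mxdotZr mxdot_gram lerBlDl lerDr pmulr_rge0 //.
by rewrite divr_gt0 // nsq_gt0.
Qed.

End Nearest.

(** Each [F0 U] with [U] orthogonal has the Gram matrix and the norm of [F0], so nearness says that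
    [U = 1] maximizes [<F0^T F, U>]. *)
Lemma nearest_psd n k (F F0 : 'M[R]_(n, k)) :
  (forall G, G *m G^T = F0 *m F0^T -> nsq (F - F0) <= nsq (F - G)) ->
  psdmx (F0^T *m F).
Proof.
move=> h; apply: procrustes_psd => U UU.
have := h (F0 *m U); rewrite trmx_mul mulmxA -(mulmxA F0) UU mulmx1 => /(_ erefl).
have -> : mxdot (F0^T *m F) U = mxdot F (F0 *m U) by rewrite mxdot_mull trmxK.
have -> : mxdot (F0^T *m F) 1%:M = mxdot F F0 by rewrite mxdot_mull trmxK mulmx1.
have e : nsq (F0 *m U) = nsq F0 by rewrite {1}/nsq mxdot_mulr -mulmxA UU mulmx1.
by rewrite !nsqB e; lra.
Qed.

(** * Gram factorizations of positive semidefinite matrices *)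

(** Cholesky factorization by induction on the size, applied to the Schur complement [Y - u u^T / a]
    of the corner entry. *)
Lemma psdmx_square_factor n (X : 'M[R]_n) :
  psdmx X -> exists F : 'M[R]_n, F *m F^T = X.
Proof.
elim: n X => [X _|n IH X pX]; first by exists 0; apply/matrixP => -[].
have [Xs Xp] := pX.
pose X' : 'M[R]_(1 + n) := X.
pose a := X' 0 0; pose u : 'cV[R]_n := dlsubmx X'; pose Y : 'M[R]_n := drsubmx X'.
have XE : X' = block_mx a%:M u^T u Y.
  rewrite -(submxK X'); congr block_mx.
    by rewrite [LHS]mx11_scalar !mxE !lshift0.
  by rewrite /u trmx_dlsub [X'^T]Xs.
have Ys : Y^T = Y by rewrite /Y trmx_drsub [X'^T]Xs.
have qf x (w : 'cV[R]_n) : 0 <= a * x ^+ 2 + 2 * x * mxdot u w + mxdot w (Y *m w).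
  have : 0 <= @mxdot R (1 + n) 1 (col_mx x%:M w) (X' *m col_mx x%:M w) by exact: Xp.
  rewrite XE mul_block_col mxdot_col_mx !mxdotDr -scalar_mxM mul_mx_scalar mxdotZr.
  rewrite (mx11_scalar (u^T *m w)) -mxdot_cV (mxdotC w u).
  have e (s t : R) : mxdot (s%:M : 'M[R]_1) t%:M = s * t.
    by rewrite mxdotE !big_ord1 !mxE eqxx !mulr1n.
  by rewrite !e => h; apply: le_trans h _; rewrite le_eqVlt; apply/orP; left; apply/eqP; ring.
have a0 : 0 <= a by have := qf 1 0; rewrite mulmx0 !mxdot0r; lra.
have u0 : a = 0 -> u = 0.
  move=> az; apply: nsq_eq0.
  suff : 2 * nsq u = 0 by lra.
  apply: (@quad_ge0_lin0 _ (mxdot u (Y *m u)) 1) => // t _.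
  have := qf 1 (t *: u).
  by rewrite az -scalemxAr !mxdotZr mxdotZl -/(nsq u); lra.
have [F' F'E] : exists F' : 'M[R]_n, F' *m F'^T = Y - a^-1 *: (u *m u^T).
  apply: IH; split.
    by rewrite trB trZ trmx_mul trmxK Ys.
  (* This first coordinate minimizes the form for fixed [w], and the minimum is the Schur complement
     at [w]. For [a = 0], the convention [0^-1 = 0] and [u = 0] leave [Y]. *)
  move=> w; have := qf (- (mxdot u w / a)) w.
  rewrite mulmxBl mxdotBr -scalemxAl mxdotZr -mulmxA.
  have -> : mxdot w (u *m (u^T *m w)) = mxdot u w ^+ 2.
    by rewrite (mx11_scalar (u^T *m w)) -mxdot_cV mul_mx_scalar mxdotZr mxdotC.
  have [az|an] := eqVneq a 0.
    by rewrite az u0 // invr0 !mxdot0l; lra.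
  by congr (0 <= _); field.
pose F : 'M[R]_(1 + n) := block_mx (Num.sqrt a)%:M 0 ((Num.sqrt a)^-1 *: u) F'.
exists F; rewrite -[RHS]/X' XE; change (F *m F^T = block_mx a%:M u^T u Y).
have sa : Num.sqrt a * (Num.sqrt a)^-1 *: u = u.
  have [az|an] := eqVneq a 0; first by rewrite u0 // scaler0.
  by rewrite mulfV ?scale1r // gt_eqF // sqrtr_gt0 lt_neqAle eq_sym an.
have sqa : Num.sqrt a * Num.sqrt a = a by rewrite -expr2 sqr_sqrtr.
rewrite /F tr_block_mx mulmx_block !trmx0 !mul0mx !mulmx0 !addr0 tr_scalar_mx.
rewrite !trZ !mul_scalar_mx mul_mx_scalar !scalerA; congr block_mx.
- by rewrite scale_scalar_mx sqa.
- by rewrite -trZ; congr trmx; exact: sa.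
- exact: sa.
- by rewrite -scalemxAl -scalemxAr scalerA -invfM sqa F'E addrC subrK.
Qed.

(** Since [Q B = 1], [X = Q^T (B^T X B) Q]; a square factor of the [k] by [k] compression [B^T X B]
    gives one of [X] with [k] columns. *)
Lemma psdmx_base_factor n k (X : 'M[R]_n) (L : 'M[R]_(n, k)) (Q : 'M[R]_(k, n))
    (B : 'M[R]_(n, k)) :
  psdmx X -> X = L *m Q -> Q *m B = 1%:M ->
  exists F : 'M[R]_(n, k), F *m F^T = X.
Proof.
move=> pX XE QB; have [Xs Xp] := pX.
have XBQ : X *m B *m Q = X by rewrite XE -!mulmxA (mulmxA Q) QB mul1mx.
have QBX : Q^T *m B^T *m X = X.
  by rewrite -[RHS]Xs -[in RHS]XBQ !trmx_mul Xs mulmxA.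
have [|G GG] := @psdmx_square_factor _ (B^T *m X *m B).
  split=> [|v]; first by rewrite !trmx_mul trmxK Xs mulmxA.
  by rewrite -!mulmxA -mxdot_mull.
exists (Q^T *m G).
by rewrite trmx_mul trmxK mulmxA -(mulmxA _ G) GG !mulmxA QBX XBQ.
Qed.

Lemma psdmx_rank_factor n (X : 'M[R]_n) :
  psdmx X -> exists F : 'M[R]_(n, \rank X), F *m F^T = X.
Proof.
have /row_freeP[B QB] := row_base_free X; move=> pX.
exact: (psdmx_base_factor pX (esym (mulmx_base X)) QB).
Qed.

End PSD.

(** * Geometry of the factored problem near the solution *)

Section Operator.
Variables (R : realType) (n m : nat) (B : 'I_m -> 'M[R]_n).

Definition opA (M : 'M[R]_n) : 'cV[R]_m := \col_l mxdot (B l) M.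
Definition adjA (y : 'cV[R]_m) : 'M[R]_n := \sum_l y l 0 *: B l.

Lemma opAD M N : opA (M + N) = opA M + opA N.
Proof. by apply/matrixP => i j; rewrite !mxE mxdotDr. Qed.

Lemma opAZ a M : opA (a *: M) = a *: opA M.
Proof. by apply/matrixP => i j; rewrite !mxE mxdotZr. Qed.

Lemma opA_adj M y : mxdot (opA M) y = mxdot M (adjA y).
Proof.
rewrite mxdotE big_ord1 [RHS]mxdotC mxdot_suml; apply: eq_bigr => l _.
by rewrite !mxE mxdotZl mulrC.
Qed.

Lemma adjAD y z : adjA (y + z) = adjA y + adjA z.
Proof.
by rewrite /adjA -big_split; apply: eq_bigr => l _; rewrite mxE scalerDl.
Qed.

Lemma adjAZ a y : adjA (a *: y) = a *: adjA y.
Proof.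
by rewrite /adjA scaler_sumr; apply: eq_bigr => l _; rewrite mxE scalerA.
Qed.

Lemma adjA0 : adjA 0 = 0.
Proof. by rewrite -(scale0r 0) adjAZ scale0r. Qed.

Lemma cont_opA (T : topologicalType) (f : T -> 'M[R]_n) :
  continuous f -> continuous (fun x => opA (f x)).
Proof.
move=> cf; apply: cont_mx => i j; under eq_fun do rewrite mxE.
by apply: cont_mxdot => //; exact: cont_cst.
Qed.

Lemma cont_adjA (T : topologicalType) (f : T -> 'cV[R]_m) :
  continuous f -> continuous (fun x => adjA (f x)).
Proof.
move=> cf; apply: cont_mx => i j.
under eq_fun do rewrite summxE.
apply: cont_rsum => l; under eq_fun do rewrite mxE.
by apply: cont_rmul; [exact: cont_entry|exact: cont_cst].
Qed.

Hypothesis Bs : forall l, (B l)^T = B l.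

Lemma opA_tr M : opA M^T = opA M.
Proof. by apply/matrixP => i j; rewrite !mxE -{1}Bs mxdot_trmx. Qed.

Lemma adjA_sym y : (adjA y)^T = adjA y.
Proof.
rewrite /adjA linear_sum /=; apply: eq_bigr => l _.
by rewrite trZ Bs.
Qed.

End Operator.

Local Ltac continuity_mx := repeat lazymatch goal with
  | |- continuous (fun _ => ?c) => exact: cont_cst
  | |- continuous (fun x => x) => exact: cont_id
  | |- continuous (fun x => fst (@?f x)) => refine (@cont_fst _ _ _ f _)
  | |- continuous (fun x => snd (@?f x)) => refine (@cont_snd _ _ _ f _)
  | |- continuous fst => refine (@cont_fst _ _ _ _ (@cont_id _))
  | |- continuous snd => refine (@cont_snd _ _ _ _ (@cont_id _))
  | |- continuous (fun x => nsq (@?f x)) => refine (@cont_nsq _ _ _ _ f _)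
  | |- continuous (fun x => mxdot (@?f x) (@?g x)) => refine (@cont_mxdot _ _ _ _ f g _ _)
  | |- continuous (fun x => (@?f x)^T) => refine (@cont_tr _ _ _ _ f _)
  | |- continuous (fun x => opA _ (@?f x)) => refine (@cont_opA _ _ _ _ _ f _)
  | |- continuous (fun x => adjA _ (@?f x)) => refine (@cont_adjA _ _ _ _ _ f _)
  | |- continuous (fun x => (@?f x) *m (@?g x)) => refine (@cont_mul _ _ _ _ _ f g _ _)
  | |- continuous (fun x => (@?f x) *: (@?g x)) => refine (@cont_scale _ _ _ _ f g _ _)
  | |- continuous (fun x => - (@?f x)) =>
      first [refine (@cont_opp _ _ _ _ f _) | refine (@cont_ropp _ _ f _)]
  | |- continuous (fun x => (@?f x) + (@?g x)) =>
      first [refine (@cont_add _ _ _ _ f g _ _) | refine (@cont_radd _ _ f g _ _)]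
  | |- continuous (fun x => (@?f x) * (@?g x)) => refine (@cont_rmul _ _ f g _ _)
  end.

(** * Quadratic forms at the solution and their stability *)

Section LocalGeometry.
Variables (R : realType) (n m k : nat) (B : 'I_m -> 'M[R]_n).
Variables (Z Xst : 'M[R]_n) (rho : R).
Hypothesis Bs : forall l, (B l)^T = B l.
Hypotheses (pZ : psdmx Z) (pX : psdmx Xst).
Hypotheses (rankX : \rank Xst = k) (rankXZ : (\rank Xst + \rank Z)%N = n).
Hypothesis compl : mxdot Z Xst = 0.
Hypothesis uniq : forall X, psdmx X -> opA B X = opA B Xst -> mxdot Z X = 0 -> X = Xst.
Hypothesis rho0 : 0 < rho.

Notation A := (opA B).
Notation As := (adjA B).

(** The gradient of [penal] in [X] at [X = F F^T], see [penal_expand]; it is [Z] when [F F^T = Xst]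
    and [d = 0]. *)
Definition slackF (F : 'M[R]_(n, k)) (d : 'cV[R]_m) : 'M[R]_n :=
  Z + rho *: As (A (F *m F^T) - A Xst - d).

(* [D |-> gradlin (F, G, d) D] is linear; on [D = G] it is the gradient at
   [F + G] when [F] is stationary (lemma [bmgrad_gradlin]). *)
Definition gradlin (x : 'M[R]_(n, k) * 'M[R]_(n, k) * 'cV[R]_m) (D : 'M[R]_(n, k)) :=
  2 *: (slackF x.1.1 x.2 *m D) +
  (2 * rho) *: (As (A (x.1.1 *m D^T + D *m x.1.1^T + D *m x.1.2^T)) *m (x.1.1 + x.1.2)).

Lemma trmx_slackF F d : (slackF F d)^T = slackF F d.
Proof. by rewrite /slackF trD trZ adjA_sym //; case: pZ => ->. Qed.

Section Factor.
Variable F : 'M[R]_(n, k).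
Hypothesis FF : F *m F^T = Xst.

Lemma factor_full : row_full F.
Proof.
by rewrite /row_full eqn_leq rank_leq_col -{1}rankX -FF mxrankM_maxl.
Qed.

Lemma slack_factor : Z *m F = 0.
Proof. by apply: psdmx_mxdot_eq0 => //; rewrite -mxdot_gram FF. Qed.

(** Complementarity puts the range of [F] inside the kernel of [Z], and strict complementarity makes
    the dimensions agree. *)
Lemma ker_slack q (D : 'M[R]_(n, q)) : Z *m D = 0 -> exists T, D = F *m T.
Proof.
have [Zs _] := pZ.
move=> ZD.
have sub (p : nat) (G : 'M[R]_(n, p)) : Z *m G = 0 -> (G^T <= kermx Z)%MS.
  by move=> ZG; apply/sub_kermxP; rewrite -{1}Zs -trmx_mul ZG trmx0.
have eqF : (F^T == kermx Z)%MS.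
  rewrite -(mxrank_leqif_eq (sub _ _ slack_factor)) mxrank_ker mxrank_tr.
  move: factor_full; rewrite /row_full => /eqP ->.
  by rewrite -{1}rankXZ rankX addnK.
have : (D^T <= F^T)%MS by rewrite (eqmxP eqF) sub.
move=> /submxP[T DT]; exists T^T.
by rewrite -(trmxK D) DT trmx_mul trmxK.
Qed.

(** For small [t > 0], [F (1 + t E) F^T] is positive semidefinite, has the measurements of [Xst] and
    is orthogonal to [Z], so uniqueness makes it equal to [Xst]. *)
Lemma opA_inj_face E : E^T = E -> A (F *m E *m F^T) = 0 -> F *m E *m F^T = 0.
Proof.
move=> Es AE.
(* The parameter set is a single point: all that is wanted is [L] with [- <v, E v> <= L |v|^2], so
   that [1 + E / L] is positive semidefinite. *)
have [|x a v|L L0 hL] := @hom_bound R R k 1 [set (0 : R)]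
    (fun xv => - mxdot xv.2 (E *m xv.2)) (@compact_set1 R 0).
- continuity_mx.
- by rewrite /= -scalemxAr mxdotZl mxdotZr; ring.
pose t := L^-1; have t0 : 0 < t by rewrite invr_gt0.
have e : F *m (1%:M + t *: E) *m F^T = Xst + t *: (F *m E *m F^T).
  by rewrite mulmxDr mulmx1 mulmxDl FF -scalemxAr -scalemxAl.
have : F *m (1%:M + t *: E) *m F^T = Xst.
  apply: uniq.
  - split=> [|v]; first by rewrite !trmx_mul trmxK trD trZ trmx1 Es mulmxA.
    rewrite -!mulmxA -{1}(trmxK F) -mxdot_mull.
    set w := F^T *m v; rewrite mulmxDl mul1mx -scalemxAl mxdotDr mxdotZr.
    have := hL 0 w erefl; rewrite /= => h.
    have : t * (- mxdot w (E *m w)) <= t * (L * nsq w) by rewrite ler_pM2l.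
    by rewrite mulrA mulVf ?gt_eqF // mul1r mulrN /nsq; lra.
  - by rewrite e opAD opAZ AE scaler0 addr0.
  - rewrite mxdotC -mulmxA mxdot_mull -[Z]trmxK; case: pZ => -> _.
    by rewrite -trmx_mul slack_factor trmx0 mxdot0r.
rewrite e -[RHS]addr0 => /addrI /eqP; rewrite scaler_eq0 gt_eqF //=.
by move=> /eqP.
Qed.

End Factor.

Notation T := ('M[R]_(n, k) * 'M[R]_(n, k) * 'cV[R]_m)%type.

Definition dist_opt (x : T) : R :=
  nsq (x.1.1 *m x.1.1^T - Xst) + nsq x.1.2 + nsq x.2.

(* The second summand vanishes on the directions [D] orthogonal to the orbit of
   [F], for which [F^T D] is symmetric; it makes the form definite. *)
Definition form_grad (xD : T * 'M[R]_(n, k)) : R :=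
  mxdot (gradlin xD.1 xD.2) xD.2 + nsq (xD.1.1.1^T *m xD.2 - xD.2^T *m xD.1.1.1).

(** At the solution the slack matrix vanishes on the range of [F]; the second summand, zero on the
    orthogonal complement, restores definiteness. *)
Definition form_slack (xv : T * 'cV[R]_n) : R :=
  mxdot xv.2 (slackF xv.1.1.1 xv.1.2 *m xv.2) + nsq (xv.1.1.1^T *m xv.2).

(** [A] vanishes on antisymmetric matrices, so the second summand controls the antisymmetric part of
    [E]. *)
Definition form_face (xE : T * 'M[R]_k) : R :=
  nsq (A (xE.1.1.1 *m xE.2 *m xE.1.1.1^T)) + nsq (xE.2 - xE.2^T).

Lemma gradlinZ x a D : gradlin x (a *: D) = a *: gradlin x D.
Proof.
rewrite /gradlin trZ -!scalemxAr -!scalemxAl -!scalerDr opAZ adjAZ -scalemxAl.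
by rewrite scalerDr !scalerA ![_ * a]mulrC.
Qed.

Lemma form_gradZ x a D : form_grad (x, a *: D) = a ^+ 2 * form_grad (x, D).
Proof.
rewrite /form_grad /= gradlinZ trZ -!scalemxAr -!scalemxAl -scalerBr nsqZ.
by rewrite mxdotZl mxdotZr; ring.
Qed.

Lemma form_slackZ x a D : form_slack (x, a *: D) = a ^+ 2 * form_slack (x, D).
Proof.
by rewrite /form_slack /= -!scalemxAr nsqZ mxdotZl mxdotZr; ring.
Qed.

Lemma form_faceZ x a D : form_face (x, a *: D) = a ^+ 2 * form_face (x, D).
Proof.
rewrite /form_face /= trZ -scalerBr -!scalemxAr -scalemxAl opAZ !nsqZ.
by rewrite mulrDr.
Qed.

Lemma cont_dist_opt : continuous dist_opt.
Proof. rewrite /dist_opt; continuity_mx. Qed.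

Lemma cont_gradlin : continuous (fun xD : T * 'M[R]_(n, k) => gradlin xD.1 xD.2).
Proof. rewrite /gradlin /slackF; continuity_mx. Qed.

Lemma cont_form_grad : continuous form_grad.
Proof. rewrite /form_grad /gradlin /slackF; continuity_mx. Qed.

Lemma cont_form_slack : continuous form_slack.
Proof. rewrite /form_slack /slackF; continuity_mx. Qed.

Lemma cont_form_face : continuous form_face.
Proof. rewrite /form_face; continuity_mx. Qed.

Lemma dist_opt_le0 x : dist_opt x <= 0 ->
  [/\ x.1.1 *m x.1.1^T = Xst, x.1.2 = 0, x.2 = 0 & slackF x.1.1 x.2 = Z].
Proof.
rewrite /dist_opt => h.
have h1 := nsq_ge0 (x.1.1 *m x.1.1^T - Xst).
have h2 := nsq_ge0 x.1.2; have h3 := nsq_ge0 x.2.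
have e1 : x.1.1 *m x.1.1^T = Xst.
  by apply/eqP; rewrite -subr_eq0; apply/eqP; apply: nsq_eq0; lra.
have e3 : x.2 = 0 by apply: nsq_eq0; lra.
split => //; first by apply: nsq_eq0; lra.
by rewrite /slackF e1 e3 subrr subr0 adjA0 scaler0 addr0.
Qed.

(** At the solution the first summand is [2 <D, Z D> + 4 rho |A (D F^T)|^2]. If the form vanishes,
    then [D = F V], the matrix [F (V^T + V) F^T] lies in the kernel of [A] and so is zero, and
    [antisym_sym_eq0] gives [D = 0]. *)
Lemma form_grad_gt0 x D : dist_opt x <= 0 -> D != 0 -> 0 < form_grad (x, D).
Proof.
case: x => [[F G] d] /dist_opt_le0 /= [FF G0 _ SZ].
rewrite ltNge; apply: contra; rewrite /form_grad /gradlin /= SZ G0 trmx0 mulmx0 !addr0.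
set w := A (D *m F^T).
have Aw : A (F *m D^T + D *m F^T) = 2 *: w.
  by rewrite opAD -[F *m D^T]trmxK opA_tr // trmx_mul trmxK -/w scaler_nat mulr2n.
have -> : mxdot (2 *: (Z *m D) + (2 * rho) *: (As (A (F *m D^T + D *m F^T)) *m F)) D =
    2 * mxdot D (Z *m D) + 4 * rho * nsq w.
  rewrite mxdotDl !mxdotZl Aw adjAZ -scalemxAl mxdotZl (mxdot_mulr F).
  by rewrite (mxdotC _ (D *m F^T)) -opA_adj -/w (mxdotC _ D) /nsq; ring.
have h1 := psdmx_mxdot_ge0 D pZ; have h2 := nsq_ge0 w.
have h3 := nsq_ge0 (F^T *m D - D^T *m F).
have h2' : 0 <= 4 * rho * nsq w by rewrite !mulr_ge0 // ltW.
move=> h.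
have ZD : Z *m D = 0 by apply: psdmx_mxdot_eq0 => //; lra.
have w0 : w = 0.
  apply: nsq_eq0; have /eqP : 4 * rho * nsq w = 0 by lra.
  by rewrite mulf_eq0 (gt_eqF (_ : 0 < 4 * rho)) ?mulr_gt0 // => /eqP.
have sym : F^T *m D = D^T *m F.
  by apply/eqP; rewrite -subr_eq0; apply/eqP; apply: nsq_eq0; lra.
have [V DV] := ker_slack FF ZD.
apply/eqP; apply: (antisym_sym_eq0 _ _ sym).
  move=> M FM; have /row_fullP[C CF] := factor_full FF.
  by rewrite -(mul1mx M) -CF -mulmxA FM mulmx0.
have e : F *m D^T + D *m F^T = F *m (V^T + V) *m F^T.
  by rewrite DV trmx_mul mulmxDr mulmxDl !mulmxA.
rewrite e; apply: (opA_inj_face FF); first by rewrite trD trmxK addrC.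
by rewrite -e Aw w0 scaler0.
Qed.

Lemma form_slack_gt0 x v : dist_opt x <= 0 -> v != 0 -> 0 < form_slack (x, v).
Proof.
case: x => [[F G] d] /dist_opt_le0 /= [FF G0 _ SZ].
rewrite ltNge; apply: contra; rewrite /form_slack /= SZ => h.
have h1 := psdmx_mxdot_ge0 v pZ; have h2 := nsq_ge0 (F^T *m v).
have [|V vV] := @ker_slack _ FF _ v; first by apply: psdmx_mxdot_eq0 => //; lra.
have Fv : F^T *m v = 0 by apply: nsq_eq0; lra.
apply/eqP; apply: nsq_eq0.
by rewrite /nsq {1}vV mxdot_mull Fv mxdot0r.
Qed.

Lemma form_face_gt0 x E : dist_opt x <= 0 -> E != 0 -> 0 < form_face (x, E).
Proof.
case: x => [[F G] d] /dist_opt_le0 /= [FF G0 _ SZ].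
rewrite ltNge; apply: contra; rewrite /form_face /= => h.
have h1 := nsq_ge0 (A (F *m E *m F^T)); have h2 := nsq_ge0 (E - E^T).
have Es : E^T = E.
  by apply/esym/eqP; rewrite -subr_eq0; apply/eqP; apply: nsq_eq0; lra.
have /(opA_inj_face FF Es) FEF : A (F *m E *m F^T) = 0 by apply: nsq_eq0; lra.
have /row_fullP[C CF] := factor_full FF.
apply/eqP; rewrite -(mul1mx E) -(mulmx1 (_ *m E)) -{2}trmx1 -CF trmx_mul.
by rewrite mulmxA -(mulmxA C) -(mulmxA C) FEF mulmx0 mul0mx.
Qed.

(** Bounds [|F|^2], the trace of [F F^T], when [H = F F^T - Xst] has [|H| <= 1], through
    [2 <1, H> <= |1|^2 + |H|^2]. *)
Definition fbound : R := mxdot 1%:M Xst + (nsq (1%:M : 'M[R]_n) + 1) / 2.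

Lemma nsq_factor_bound (F : 'M[R]_(n, k)) :
  nsq (F *m F^T - Xst) <= 1 -> nsq F <= fbound.
Proof.
move=> h; have -> : nsq F = mxdot 1%:M (F *m F^T) by rewrite mxdot_gram mul1mx.
have -> : F *m F^T = Xst + (F *m F^T - Xst) by rewrite addrC subrK.
rewrite mxdotDr /fbound lerD2l.
have := nsq_ge0 (1%:M - (F *m F^T - Xst)); rewrite nsqB; lra.
Qed.

Lemma stable_forms : exists tau L : R, [/\ 0 < tau, tau <= 1, 0 < L &
  forall x, dist_opt x <= tau ->
  [/\ forall D, tau * nsq D <= form_grad (x, D),
      forall D, nsq (gradlin x D) <= L * nsq D,
      forall v, tau * nsq v <= form_slack (x, v)
    & forall E, tau * nsq E <= form_face (x, E)]].
Proof.
pose K := [set F : 'M[R]_(n, k) | nsq F <= fbound] `*`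
  [set F : 'M[R]_(n, k) | nsq F <= 1] `*` [set d : 'cV[R]_m | nsq d <= 1].
have cK : compact K.
  by apply: compact_setX; [apply: compact_setX|]; exact: compact_nsq_ball.
have xK x : dist_opt x <= 1 -> K x.
  case: x => [[F G] d]; rewrite /dist_opt /= => h.
  have h1 := nsq_ge0 (F *m F^T - Xst); have h2 := nsq_ge0 G; have h3 := nsq_ge0 d.
  by split; [split => /=; [apply: nsq_factor_bound|]|rewrite /=]; lra.
have [t1 t10 h1] := hom_stab cK cont_dist_opt cont_form_grad form_gradZ
  (fun x D _ => @form_grad_gt0 x D).
have [t2 t20 h2] := hom_stab cK cont_dist_opt cont_form_slack form_slackZ
  (fun x D _ => @form_slack_gt0 x D).
have [t3 t30 h3] := hom_stab cK cont_dist_opt cont_form_face form_faceZ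
  (fun x D _ => @form_face_gt0 x D).
have [|x a D|L L0 hL] := @hom_bound _ _ _ _ _ (fun xD => nsq (gradlin xD.1 xD.2)) cK.
- by apply: cont_nsq; exact: cont_gradlin.
- by rewrite /= gradlinZ nsqZ.
pose tau := Num.min 1 (Num.min t1 (Num.min t2 t3)).
have tt : [/\ tau <= 1, tau <= t1, tau <= t2 & tau <= t3].
  by rewrite /tau; split; rewrite !ge_min lexx ?orbT.
case: tt => tt1 tt2 tt3 tt4.
exists tau, L; split => //; first by rewrite /tau !lt_min ltr01 t10 t20 t30.
move=> x hx; have Kx : K x by apply: xK; lra.
have low (t a b : R) : tau <= t -> 0 <= a -> t * a <= b -> tau * a <= b.
  by move=> tt a0; apply: le_trans; rewrite ler_wpM2r.
split=> [D|D|v|E].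
- by apply: (low t1) => //; [exact: nsq_ge0|apply: h1 => //; lra].
- exact: (hL x D Kx).
- by apply: (low t2) => //; [exact: nsq_ge0|apply: h2 => //; lra].
- by apply: (low t3) => //; [exact: nsq_ge0|apply: h3 => //; lra].
Qed.

(* The augmented Lagrangian up to a constant, for [d = (y - ystar) / rho]. *)
Definition penal (X : 'M[R]_n) (d : 'cV[R]_m) : R :=
  mxdot Z X + rho / 2 * nsq (A X - A Xst - d).

(** * Expansion of the objective and stationarity of interior minimizers *)

Lemma penal_expand F d H :
  penal (F *m F^T + H) d =
  penal (F *m F^T) d + mxdot (slackF F d) H + rho / 2 * nsq (A H).
Proof.
rewrite /penal /slackF mxdotDr opAD.
have -> : A (F *m F^T) + A H - A Xst - d = (A (F *m F^T) - A Xst - d) + A H.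
  by apply/matrixP => i j; rewrite !mxE; ring.
set u := A (F *m F^T) - A Xst - d.
rewrite nsqD mxdotDl mxdotZl (mxdotC (As _)) -opA_adj (mxdotC (A H)).
by field.
Qed.

Lemma gram_addE (F D : 'M[R]_(n, k)) :
  (F + D) *m (F + D)^T = F *m F^T + (F *m D^T + D *m F^T + D *m D^T).
Proof. by rewrite trD mulmxDl !mulmxDr !addrA. Qed.

Lemma mxdot_slackF F d D :
  mxdot (slackF F d) (F *m D^T + D *m F^T) = 2 * mxdot (slackF F d *m F) D.
Proof.
rewrite mxdotDr (mxdot_mulr F) -[mxdot _ (F *m _)]mxdot_trmx trmx_slackF.
by rewrite trmx_mul trmxK; ring.
Qed.

(** Along [F + t D] with [D = slackF F d *m F] the objective changes by [2 t |D|^2] plus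
    higher-order terms, and an interior minimizer allows both signs of [t]. *)
Lemma ball_min_stationary (b : R) F d : nsq F < b ->
  (forall G : 'M[R]_(n, k), nsq G <= b -> penal (F *m F^T) d <= penal (G *m G^T) d) ->
  slackF F d *m F = 0.
Proof.
move=> Fb Fmin; set D := slackF F d *m F; set S := slackF F d.
set u := A (F *m D^T + D *m F^T); set v := A (D *m D^T).
(* For [|t| <= 1], [|F + t D|^2 <= |F|^2 + |t| e], so [t0] keeps the segment in the ball. *)
pose e := 2 * `|mxdot F D| + nsq D + 1.
have nD := nsq_ge0 D; have nFD := normr_ge0 (mxdot F D).
have e0 : 0 < e by rewrite /e; lra.
pose t0 := Num.min 1 ((b - nsq F) / e).
have t00 : 0 < t0 by rewrite lt_min ltr01 divr_gt0 // subr_gt0.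
suff : 2 * nsq D = 0 by move=> h; apply: nsq_eq0; lra.
(* The cubic and quartic terms are absorbed by [|u + t v|^2 <= 2 (|u|^2 + |v|^2)] for [|t| <= 1]. *)
apply: (quad_ge0_lin0 (b := mxdot S (D *m D^T) + rho * (nsq u + nsq v)) t00).
move=> t; rewrite le_min => /andP[t1].
rewrite ler_pdivlMr // => te.
have tt := normr_ge0 t.
have t2 : t ^+ 2 <= `|t| by rewrite -real_normK ?num_real //; nra.
have tFD : t * mxdot F D <= `|t| * `|mxdot F D| by rewrite -normrM ler_norm.
have : nsq (F + t *: D) <= b.
  rewrite nsqD nsqZ mxdotZr.
  have h2 : t ^+ 2 * nsq D <= `|t| * nsq D by rewrite ler_wpM2r.
  move: te; rewrite /e !mulrDr; lra.
move=> /Fmin; rewrite gram_addE penal_expand.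
have -> : F *m (t *: D)^T + t *: D *m F^T + t *: D *m (t *: D)^T =
    t *: (F *m D^T + D *m F^T) + (t ^+ 2) *: (D *m D^T).
  by rewrite !trZ -!scalemxAl -!scalemxAr scalerDr scalerA -expr2.
rewrite mxdotDr !mxdotZr mxdot_slackF -/D -/S -/(nsq D) opAD !opAZ -/u -/v.
have -> : t *: u + t ^+ 2 *: v = t *: (u + t *: v) by rewrite scalerDr scalerA -expr2.
rewrite nsqZ.
have h1 : nsq (u + t *: v) <= 2 * (nsq u + nsq v).
  have := nsq_ge0 (u - t *: v); rewrite nsqB nsqD nsqZ.
  have t21 : t ^+ 2 <= 1 by lra.
  have : t ^+ 2 * nsq v <= 1 * nsq v by rewrite ler_wpM2r // nsq_ge0.
  lra.
have h2 : rho / 2 * (t ^+ 2 * nsq (u + t *: v)) <= rho / 2 * (t ^+ 2 * (2 * (nsq u + nsq v))).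
  by rewrite ler_pM2l ?divr_gt0 // ler_wpM2l // sqr_ge0.
lra.
Qed.

(** If [K F^T = 0], the symmetric matrix [E = K^T K] satisfies [F E = 0], so the bound forces
    [E = 0] and then [K = 0]. *)
Lemma face_row_full tau F : 0 < tau ->
  (forall G d E, tau * nsq E <= form_face (F, G, d, E)) -> row_full F.
Proof.
move=> tau0 h; rewrite /row_full -mxrank_tr -/(row_free F^T) -kermx_eq0.
set K := kermx F^T.
have KF : F *m K^T = 0 by rewrite -[F]trmxK -trmx_mul mulmx_ker trmx0.
have Es : (K^T *m K)^T = K^T *m K by rewrite trmx_mul trmxK.
have := h 0 0 (K^T *m K).
rewrite /form_face /= Es subrr (mulmxA F) KF !mul0mx -(scale0r 0) opAZ scale0r.
rewrite {2 3}/nsq !mxdot0l addr0 pmulr_rle0 // => hE.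
have E0 : K^T *m K = 0 by apply: nsq_eq0; apply/eqP; rewrite eq_le hE nsq_ge0.
by rewrite -trmx_eq0; apply/eqP/mul_tr_eq0; rewrite trmxK.
Qed.

Lemma orth_decomp q (F : 'M[R]_(n, k)) (V : 'M[R]_(n, q)) : row_full F ->
  exists a W, V = F *m a + W /\ F^T *m W = 0.
Proof.
move=> /row_fullP[C CF].
have uG : F^T *m F \in unitmx.
  rewrite -row_free_unit -kermx_eq0; set K := kermx _.
  have KF : K *m F^T = 0.
    apply: mul_tr_eq0; rewrite trmx_mul trmxK mulmxA -(mulmxA K).
    by rewrite mulmx_ker mul0mx.
  by rewrite -(mulmx1 K) -trmx1 -CF trmx_mul mulmxA KF mul0mx.
exists (invmx (F^T *m F) *m (F^T *m V)), (V - F *m (invmx (F^T *m F) *m (F^T *m V))).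
split; first by rewrite addrC subrK.
by rewrite mulmxBr mulmxA mulmxA mulmxV // mul1mx subrr.
Qed.

(** * Stationary factors solve the penalized problem *)

Section Solution.
Variables (tau : R) (F : 'M[R]_(n, k)) (d : 'cV[R]_m).
Hypothesis tau0 : 0 < tau.
Hypothesis hS : forall G v, tau * nsq v <= form_slack (F, G, d, v).
Hypothesis hE : forall G c E, tau * nsq E <= form_face (F, G, c, E).
Hypothesis stat : slackF F d *m F = 0.

Lemma stat_tr : F^T *m slackF F d = 0.
Proof. by rewrite -[slackF F d]trmx_slackF -trmx_mul stat trmx0. Qed.

(** Stationarity removes the range of [F] from the quadratic form; on its orthogonal complement [hS]
    gives the lower bound. *)
Lemma slackF_psd : psdmx (slackF F d).
Proof.
split=> [|v]; first exact: trmx_slackF.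
have [a [w [-> Fw]]] := orth_decomp v (face_row_full tau0 hE).
rewrite mulmxDr mulmxA stat mul0mx add0r mxdotDl mxdot_mull mulmxA stat_tr.
rewrite mul0mx mxdot0r add0r.
have := hS 0 w; rewrite /form_slack /= Fw {2}/nsq mxdot0l addr0.
by apply: le_trans; rewrite mulr_ge0 ?nsq_ge0 // ltW.
Qed.

Lemma slackF_ker q (V : 'M[R]_(n, q)) : slackF F d *m V = 0 -> exists a, V = F *m a.
Proof.
have [a [W [VE FW]]] := orth_decomp V (face_row_full tau0 hE).
rewrite VE mulmxDr mulmxA stat mul0mx add0r => SW.
exists a; rewrite -[RHS]addr0; congr (_ + _).
apply/matrixP => i j; rewrite [RHS]mxE.
suff /matrixP/(_ i 0) : col j W = 0 by rewrite !mxE.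
apply: nsq_eq0; have := hS 0 (col j W).
rewrite /form_slack /= -!col_mulmx SW FW !col0 /nsq mxdot0r mxdot0l addr0.
by rewrite pmulr_rle0 // => h; apply/eqP; rewrite eq_le h nsq_ge0.
Qed.

Lemma mxdot_slackF_psd_ge0 X : psdmx X -> 0 <= mxdot (slackF F d) X.
Proof.
move=> /psdmx_square_factor[G <-].
by rewrite mxdot_gram psdmx_mxdot_ge0 //; exact: slackF_psd.
Qed.

(** Stationarity makes [<slackF F d, F F^T>] vanish. For positive semidefinite [X] both added terms
    are nonnegative, which is the sufficiency of the optimality conditions. *)
Lemma penal_diff X :
  penal X d = penal (F *m F^T) d + mxdot (slackF F d) X + rho / 2 * nsq (A (X - F *m F^T)).
Proof.
have {1}-> : X = F *m F^T + (X - F *m F^T) by rewrite addrC subrK.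
rewrite penal_expand mxdotBr; congr (_ + _ + _).
by rewrite mxdot_gram stat mxdot0r subr0.
Qed.

Lemma penal_min X : psdmx X -> penal (F *m F^T) d <= penal X d.
Proof.
move=> pX'; rewrite (penal_diff X) -addrA lerDl addr_ge0 //.
  exact: mxdot_slackF_psd_ge0.
by rewrite mulr_ge0 ?nsq_ge0 // divr_ge0 // ltW.
Qed.

(** Both added terms of [penal_diff] must vanish. The first puts a factor of [X] in the range of
    [F], so [X - F F^T = F (a a^T - 1) F^T]; the second puts this in the kernel of [A], where [hE]
    forces [a a^T = 1]. *)
Lemma penal_min_uniq X : psdmx X -> penal X d <= penal (F *m F^T) d -> X = F *m F^T.
Proof.
move=> pX' h.
have h1 := mxdot_slackF_psd_ge0 pX'.
have h2 := nsq_ge0 (A (X - F *m F^T)).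
have h2' : 0 <= rho / 2 * nsq (A (X - F *m F^T)) by rewrite mulr_ge0 // divr_ge0 // ltW.
move: h; rewrite (penal_diff X) => h.
have SX : mxdot (slackF F d) X = 0 by lra.
have AX : A (X - F *m F^T) = 0.
  apply: nsq_eq0; have /eqP : rho / 2 * nsq (A (X - F *m F^T)) = 0 by lra.
  by rewrite mulf_eq0 gt_eqF ?divr_gt0 //= => /eqP.
have [G GX] := psdmx_square_factor pX'.
have [|a Ga] := @slackF_ker _ G.
  by apply: (psdmx_mxdot_eq0 slackF_psd); rewrite -mxdot_gram GX.
have XE : X - F *m F^T = F *m (a *m a^T - 1%:M) *m F^T.
  by rewrite -GX Ga trmx_mul mulmxBr mulmx1 mulmxBl !mulmxA.
have := hE 0 0 (a *m a^T - 1%:M).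
rewrite /form_face /= -XE AX trB trmx_mul trmxK trmx1 subrr /nsq !mxdot0l addr0.
rewrite pmulr_rle0 // => h0.
have /nsq_eq0 E0 : nsq (a *m a^T - 1%:M) = 0 by apply/eqP; rewrite eq_le h0 nsq_ge0.
by apply/eqP; rewrite -subr_eq0 XE E0 mulmx0 mul0mx.
Qed.

(** Both factors share one slack matrix [S], and [S G (S G)^T = S F F^T S^T = 0]. *)
Lemma stat_factor G : G *m G^T = F *m F^T -> slackF G d *m G = 0.
Proof.
move=> GG; have -> : slackF G d = slackF F d by rewrite /slackF GG.
apply: mul_tr_eq0; rewrite trmx_mul mulmxA -(mulmxA _ G) GG mulmxA stat.
by rewrite !mul0mx.
Qed.

End Solution.

(** * Existence of a stationary factor near the solution *)

(** A minimizer over a large ball does at least as well as a factor of [Xst], which makes [f] of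
    order [|d|^2] there. By uniqueness [f] vanishes only where [F F^T = Xst], so compactness turns
    small [f] into closeness, and closeness puts the minimizer in the interior. *)
Lemma stationary_point r : 0 < r -> r <= 1 ->
  exists2 c, 0 < c & forall d, nsq d <= c ->
    exists2 F, nsq (F *m F^T - Xst) <= r & slackF F d *m F = 0.
Proof.
move=> r0 r1.
pose K := [set F : 'M[R]_(n, k) | nsq F <= fbound + 1].
have cK : compact K by exact: compact_nsq_ball.
pose f (F : 'M[R]_(n, k)) := mxdot Z (F *m F^T) + nsq (A (F *m F^T) - A Xst).
pose g (F : 'M[R]_(n, k)) := r - nsq (F *m F^T - Xst).
have Z0 (F : 'M[R]_(n, k)) : 0 <= mxdot Z (F *m F^T) by rewrite mxdot_gram psdmx_mxdot_ge0.
have [|||c c0 hc] := @compact_stab _ _ K f g cK.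
- by rewrite /f; continuity_mx.
- by rewrite /g; continuity_mx.
- move=> F _; rewrite /f /g => h.
  have h1 := nsq_ge0 (A (F *m F^T) - A Xst).
  have -> : F *m F^T = Xst.
    have h0 := Z0 F.
    apply: uniq; [exact: psdmx_gram| |lra].
    by apply/eqP; rewrite -subr_eq0; apply/eqP; apply: nsq_eq0; lra.
  by rewrite subrr /nsq mxdot0l subr0.
(* At the minimizer the summands of [f] are at most [rho / 2 |d|^2] and [4 |d|^2], the latter since
   [|A (F F^T) - A Xst - d| <= |d|]. *)
have rp : 0 < rho / 2 + 4 by rewrite addr_gt0 // divr_gt0.
exists (c / (rho / 2 + 4)); first by rewrite divr_gt0.
move=> d; rewrite ler_pdivlMr // => dc.
have [Fst FstE] : exists F : 'M[R]_(n, k), F *m F^T = Xst.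
  by rewrite -rankX; exact: psdmx_rank_factor.
have KFst : K Fst.
  have := @nsq_factor_bound Fst; rewrite FstE subrr {1}/nsq mxdot0l => /(_ ler01).
  by rewrite /K /=; lra.
have [||F KF Fmin] := @EVT_le _ _ K (fun F => penal (F *m F^T) d) cK.
- by exists Fst.
- by rewrite /penal; continuity_mx.
have hF : nsq (F *m F^T - Xst) <= r.
  have := Fmin _ KFst; rewrite FstE /penal (_ : A Xst - A Xst - d = - d); last first.
    by rewrite subrr sub0r.
  rewrite nsqN.
  have -> : mxdot Z Xst = 0 by [].
  rewrite add0r => h.
  have h0 := Z0 F; set u := A (F *m F^T) - A Xst in h *.
  have h1 := nsq_ge0 (u - d); have h2 := nsq_ge0 d.
  have h3 : nsq (u - d) <= nsq d.
    have : rho / 2 * nsq (u - d) <= rho / 2 * nsq d by lra.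
    by rewrite ler_pM2l // divr_gt0.
  have h4 : nsq u <= 4 * nsq d.
    have := nsq_ge0 (u - 2 *: d); move: h3.
    by rewrite !nsqB nsqZ mxdotZr; lra.
  have h5 : 0 <= rho / 2 * nsq (u - d) by rewrite mulr_ge0 // divr_ge0 // ltW.
  have : f F <= c by rewrite /f -/u; lra.
  by move=> /(hc _ KF); rewrite /g; lra.
exists F => //; apply: (@ball_min_stationary (fbound + 1)) => //.
by have := @nsq_factor_bound F; lra.
Qed.

(** When both Gram matrices equal [Xst], [gram_inj_psd] gives [F = G]; compactness makes this
    quantitative. It serves to put the first iterate close to its nearest factor. *)
Lemma procrustes_close e : 0 < e -> exists2 c, 0 < c &
  forall F G : 'M[R]_(n, k), psdmx (G^T *m F) ->
    nsq (F *m F^T - Xst) + nsq (G *m G^T - Xst) <= c -> nsq (F - G) <= e.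
Proof.
move=> e0.
pose T2 := ('M[R]_(n, k) * 'M[R]_(n, k))%type.
pose K := ([set F : 'M[R]_(n, k) | nsq F <= fbound] `*`
  [set F : 'M[R]_(n, k) | nsq F <= fbound]) `&`
  [set x : T2 | psdmx (x.2^T *m x.1)].
have cK : compact K.
  apply: compact_closedI; first by apply: compact_setX; exact: compact_nsq_ball.
  rewrite (_ : [set x : T2 | _] =
    [set x : T2 | nsq ((x.2^T *m x.1)^T - x.2^T *m x.1) = 0] `&`
    \bigcap_(v in [set: 'cV[R]_k]) [set x : T2 | 0 <= mxdot v (x.2^T *m x.1 *m v)]).
    apply: closedI; first by apply: closed_eq_fun; continuity_mx.
    by apply: closed_bigI => v _; apply: closed_le_fun; continuity_mx.
  apply/seteqP; split => x /=.
    by move=> [h1 h2]; split => [|v _]; rewrite /= ?h1 ?subrr ?/nsq ?mxdot0l.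
  move=> [h1 h2]; split=> [|v]; last exact: h2.
  by apply/eqP; rewrite -subr_eq0; apply/eqP; exact: nsq_eq0.
pose f (x : T2) := nsq (x.1 *m x.1^T - Xst) + nsq (x.2 *m x.2^T - Xst).
pose g (x : T2) := e - nsq (x.1 - x.2).
have [|||c c0 hc] := @compact_stab _ _ K f g cK.
- by rewrite /f; continuity_mx.
- by rewrite /g; continuity_mx.
- move=> [F G] [_ /= pN]; rewrite /f /g /= => h.
  have h1 := nsq_ge0 (F *m F^T - Xst); have h2 := nsq_ge0 (G *m G^T - Xst).
  have FE : F *m F^T = Xst.
    by apply/eqP; rewrite -subr_eq0; apply/eqP; apply: nsq_eq0; lra.
  have GE : G *m G^T = Xst.
    by apply/eqP; rewrite -subr_eq0; apply/eqP; apply: nsq_eq0; lra.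
  rewrite (gram_inj_psd (factor_full GE) _ pN) ?FE //.
  by rewrite subrr /nsq mxdot0l subr0.
exists (Num.min 1 c); first by rewrite lt_min ltr01.
move=> F G pN; rewrite le_min => /andP[h1 h2].
have n1 := nsq_ge0 (F *m F^T - Xst); have n2 := nsq_ge0 (G *m G^T - Xst).
have := hc (F, G); rewrite /f /g /= => hh.
suff : c <= e - nsq (F - G) by lra.
apply: hh => //; split=> //; split; apply: nsq_factor_bound; lra.
Qed.

(** * Contraction of gradient descent *)

Definition bmgrad F d : 'M[R]_(n, k) := 2 *: (slackF F d *m F).

Lemma bmgrad_gradlin F D d : slackF F d *m F = 0 ->
  bmgrad (F + D) d = gradlin (F, D, d) D.
Proof.
move=> stat; rewrite /bmgrad /gradlin /=.
have -> : slackF (F + D) d =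
    slackF F d + rho *: As (A (F *m D^T + D *m F^T + D *m D^T)).
  rewrite /slackF gram_addE opAD -[RHS]addrA -scalerDr -adjAD; congr (_ + _ *: As _).
  by apply/matrixP => i j; rewrite !mxE; ring.
rewrite mulmxDl mulmxDr stat add0r scalerDr; congr (_ + _).
by rewrite -scalemxAl scalerA.
Qed.

(** In [|D - eta G|^2 = |D|^2 - 2 eta <G, D> + eta^2 |G|^2], half of the gain [2 eta tau |D|^2] pays
    for the last term because [eta L <= tau]. Symmetry of [F^T D] removes the orbit term of
    [form_grad]. *)
Lemma gradient_step_contracts tau L eta F D d :
  tau * nsq D <= form_grad (F, D, d, D) ->
  nsq (gradlin (F, D, d) D) <= L * nsq D ->
  slackF F d *m F = 0 -> F^T *m D = D^T *m F -> 0 <= eta -> eta * L <= tau ->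
  nsq (F + D - eta *: bmgrad (F + D) d - F) <= (1 - eta * tau) * nsq D.
Proof.
move=> h1 h2 stat sym eta0 eL; rewrite bmgrad_gradlin //.
move: h1; rewrite /form_grad /= sym subrr {2}/nsq mxdot0l addr0.
set G := gradlin _ _ in h2 * => h1.
have -> : F + D - eta *: G - F = D - eta *: G.
  by apply/matrixP => i j; rewrite !mxE; ring.
rewrite nsqB nsqZ mxdotZr (mxdotC D).
have n0 := nsq_ge0 D.
have a1 : eta * (tau * nsq D) <= eta * mxdot G D by rewrite ler_wpM2l.
have a2 : eta ^+ 2 * nsq G <= eta ^+ 2 * (L * nsq D) by rewrite ler_wpM2l ?sqr_ge0.
have a3 : eta * nsq D * (eta * L) <= eta * nsq D * tau by rewrite ler_wpM2l ?mulr_ge0.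
lra.
Qed.

Lemma local_contraction : exists c cbar chat q : R,
  [/\ 0 < c, 0 < cbar, 0 < chat, 0 < q < 1 &
  forall d, nsq d <= c -> exists F0 : 'M[R]_(n, k),
  [/\ forall X, psdmx X -> penal (F0 *m F0^T) d <= penal X d,
      forall X, psdmx X -> penal X d <= penal (F0 *m F0^T) d -> X = F0 *m F0^T &
      forall (eta : R) (F G : nat -> 'M[R]_(n, k)),
        nsq (F 1%N *m (F 1%N)^T - Xst) <= chat ->
        cbar / 2 < eta < cbar ->
        (forall t, (1 <= t)%N -> F t.+1 = F t - eta *: bmgrad (F t) d) ->
        (forall t, (1 <= t)%N -> G t *m (G t)^T = F0 *m F0^T /\
           forall H, H *m H^T = F0 *m F0^T -> nsq (F t - G t) <= nsq (F t - H)) ->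
        forall t, (1 <= t)%N ->
          nsq (F t.+1 - G t.+1) <= q ^+ t * nsq (F 1%N - G 1%N)]].
Proof.
have [tau [L0 [tau0 tau1 L00 stab]]] := stable_forms.
(* [L > 1 >= tau] keeps the contraction factor positive. *)
pose L := L0 + 1.
have L1 : 1 < L by rewrite /L; lra.
have Lp : 0 < L by lra.
have stabL x : dist_opt x <= tau -> forall D, nsq (gradlin x D) <= L * nsq D.
  move=> /stab[_ h _ _] D; apply: le_trans (h D) _.
  by rewrite ler_wpM2r ?nsq_ge0 // /L; lra.
have e0 : 0 < tau / 3 by lra.
have [c5 c50 close] := procrustes_close e0.
(* Each of the three summands of [dist_opt] gets [tau / 3]; the bound [c5 / 2] leaves the other half
   of [c5] to the first iterate. *)
pose r := Num.min (tau / 3) (c5 / 2).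
have r0 : 0 < r by rewrite lt_min e0 divr_gt0.
have [r3 rc5] : r <= tau / 3 /\ r <= c5 / 2 by rewrite !ge_min !lexx orbT.
have r1 : r <= 1 by lra.
have [c c0 spt] := stationary_point r0 r1.
pose cd := Num.min c (tau / 3).
(* [eta < tau / L] gives [eta L <= tau], and [eta > tau / (2 L)] turns [1 - eta tau] into the
   uniform rate, here for squared norms. *)
exists cd, (tau / L), (c5 / 2), (1 - tau ^+ 2 / (2 * L)).
have qd : tau ^+ 2 / (2 * L) < 1.
  by rewrite ltr_pdivrMr ?mulr_gt0 // mul1r; nra.
have qp : 0 < tau ^+ 2 / (2 * L) by rewrite divr_gt0 ?exprn_gt0 // mulr_gt0.
split; [by rewrite lt_min c0|by rewrite divr_gt0|by lra|by apply/andP; split; lra|].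
move=> d; rewrite le_min => /andP[dc dt].
have [F0 F0r stat] := spt d dc; exists F0.
have dist F D : F *m F^T = F0 *m F0^T -> nsq D <= tau / 3 -> dist_opt (F, D, d) <= tau.
  by rewrite /dist_opt /= => -> h; lra.
have nsq00 : nsq (0 : 'M[R]_(n, k)) <= tau / 3 by rewrite /nsq mxdot0l ltW.
(* [form_slack] does not read its second coordinate, nor [form_face] its second and third, so the
   bounds at [(F0, 0, d)] suffice. *)
have hS G v : tau * nsq v <= form_slack (F0, G, d, v).
  have [_ _ h _] := stab (F0, 0, d) (dist _ _ erefl nsq00).
  exact: h.
have hE G c' E : tau * nsq E <= form_face (F0, G, c', E).
  have [_ _ _ h] := stab (F0, 0, d) (dist _ _ erefl nsq00).
  exact: h.
split.
- exact: (penal_min tau0 hS hE stat).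
- exact: (penal_min_uniq tau0 hS hE stat).
move=> eta F G F1 /andP[eta1 eta2] Fstep Gnear.
have etaL : eta * L <= tau by rewrite -ler_pdivlMr // ltW.
have eta0 : 0 < eta by apply: le_lt_trans eta1; rewrite divr_ge0 // divr_ge0 // ltW.
have qE : 1 - eta * tau <= 1 - tau ^+ 2 / (2 * L).
  rewrite lerD2l lerN2.
  have -> : tau ^+ 2 / (2 * L) = tau / L / 2 * tau.
    by field; rewrite gt_eqF.
  by rewrite ler_pM2r // ltW.
set q := 1 - tau ^+ 2 / (2 * L) in qE *.
have q01 : 0 <= q <= 1 by rewrite /q; apply/andP; split; lra.
case/andP: q01 => q0 q1.
have step t : (1 <= t)%N -> nsq (F t - G t) <= tau / 3 ->
    nsq (F t.+1 - G t.+1) <= q * nsq (F t - G t).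
  move=> t1 small; have [GE Gmin] := Gnear t t1.
  have [_ G'min] := Gnear t.+1 isT.
  (* The factor nearest to the new iterate is at least as close as [G t]. *)
  apply: le_trans (G'min _ GE) _; rewrite Fstep //.
  have [Ns _] : psdmx ((G t)^T *m F t).
    by apply: nearest_psd => H HE; apply: Gmin; rewrite HE GE.
  set D := F t - G t in small *.
  have FE : F t = G t + D by rewrite /D addrC subrK.
  have sym : (G t)^T *m D = D^T *m G t.
    rewrite /D trB mulmxBr mulmxBl; congr (_ - _).
    by rewrite -Ns trmx_mul trmxK.
  have dD := dist _ _ GE small.
  have [hg _ _ _] := stab _ dD.
  have statG := stat_factor stat GE.
  rewrite FE; apply: le_trans (gradient_step_contracts (hg D) (stabL _ dD D) statG sym (ltW eta0) etaL) _.
  by rewrite ler_wpM2r ?nsq_ge0.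
(* The second half keeps the iterates where the forms are stable; at [t = 0] it is the closeness of
   the first iterate. *)
have inv t : nsq (F t.+1 - G t.+1) <= q ^+ t * nsq (F 1%N - G 1%N) /\
    nsq (F t.+1 - G t.+1) <= tau / 3.
  elim: t => [|t [IH1 IH2]].
    split; first by rewrite expr0 mul1r.
    have [GE Gmin] := Gnear 1%N isT.
    apply: close; first by apply: nearest_psd => H HE; apply: Gmin; rewrite HE GE.
    by rewrite GE; lra.
  have st := step t.+1 isT IH2; split.
    by apply: le_trans st _; rewrite exprS -mulrA ler_wpM2l.
  apply: le_trans st _; apply: le_trans IH2; rewrite -[leRHS]mul1r.
  by rewrite ler_wpM2r ?nsq_ge0.
by move=> t _; case: (inv t).
Qed.

End LocalGeometry.

(** * Transfer to the semidefinite program *)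

Section Gradient.
Variables (R : realType) (n m k : nat) (B : 'I_m -> 'M[R]_n).
Variables (Z Xst : 'M[R]_n) (rho : R).
Hypothesis Bs : forall l, (B l)^T = B l.
Hypothesis pZ : psdmx Z.

Lemma mxdot_delta p q (M : 'M[R]_(p, q)) i j : mxdot M (delta_mx i j) = M i j.
Proof.
rewrite mxdotE (bigD1 j) //= [X in _ + X]big1 ?addr0 => [|s sj].
  rewrite (bigD1 i) //= [X in _ + X]big1 ?addr0 => [|l li].
    by rewrite mxE !eqxx mulr1.
  by rewrite mxE (negPf li) mulr0.
by apply: big1 => l _; rewrite mxE (negPf sj) andbF mulr0.
Qed.

(** For nonzero [t] the difference quotient is the polynomial [p t], so its limit is [p 0]. *)
Lemma derive_penal_gram c d (F D : 'M[R]_(n, k)) :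
  'D_D (fun G : 'M[R]_(n, k) => penal B Z Xst rho (G *m G^T) d + c : R^o) F =
  mxdot (bmgrad B Z Xst rho F d) D.
Proof.
apply: cvg_lim => //=.
set S := slackF B Z Xst rho F d.
pose p (t : R) : R := mxdot (2 *: (S *m F)) D + t * (mxdot S (D *m D^T) +
  rho / 2 * nsq (opA B (F *m D^T + D *m F^T) + t *: opA B (D *m D^T))).
have cp : continuous p by rewrite /p; continuity_mx.
have p0 : p 0 = mxdot (bmgrad B Z Xst rho F d) D by rewrite /p mul0r addr0.
rewrite -p0; apply: (@cvg_trans _ (p t @[t --> 0^'])); last first.
  exact: cvg_within_filter (cp 0).
apply: near_eq_cvg; near=> t.
have t0 : t != 0 by near: t; exact: nbhs_dnbhs_neq.
rewrite /= [t *: D + F]addrC gram_addE penal_expand //.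
have -> : F *m (t *: D)^T + t *: D *m F^T + t *: D *m (t *: D)^T =
    t *: (F *m D^T + D *m F^T) + (t ^+ 2) *: (D *m D^T).
  by rewrite !trZ -!scalemxAl -!scalemxAr scalerDr scalerA -expr2.
rewrite mxdotDr !mxdotZr mxdot_slackF // -/S opAD !opAZ.
set u := opA B (F *m D^T + D *m F^T); set v := opA B (D *m D^T).
have -> : t *: u + t ^+ 2 *: v = t *: (u + t *: v) by rewrite scalerDr scalerA -expr2.
rewrite nsqZ /p -/u -/v mxdotZl.
by rewrite -[_^-1 *: _]/(_^-1 * _); field.
Unshelve. all: by end_near. Qed.

Lemma gradient_penal_gram c d (F : 'M[R]_(n, k)) :
  gradient (fun G : 'M[R]_(n, k) => penal B Z Xst rho (G *m G^T) d + c) F =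
  bmgrad B Z Xst rho F d.
Proof.
apply/matrixP => i j; rewrite mxE derive_penal_gram.
exact: mxdot_delta.
Qed.

End Gradient.

Section Translation.
Variable R : realType.

Lemma mxnormF_le p q p' q' (M : 'M[R]_(p, q)) (N : 'M[R]_(p', q')) :
  (mxnormF M <= mxnormF N) = (nsq M <= nsq N).
Proof. by rewrite ler_sqrt // nsq_ge0. Qed.

Lemma mxnormF_le_sqr p q (M : 'M[R]_(p, q)) a :
  0 <= a -> (mxnormF M <= a) = (nsq M <= a ^+ 2).
Proof.
by move=> a0; rewrite -mxnormF_sqr ler_sqr // nnegrE sqrtr_ge0.
Qed.

Lemma symx_tr n (X : symx R n) : (X : 'M[R]_n)^T = X.
Proof.
case: X => M /= h; have : M \in @symx_pred R n by [].
by rewrite symx_predE => /eqP/esym.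
Qed.

Lemma symx_psd n (X : symx R n) : psd X <-> psdmx X.
Proof.
rewrite /psd /psdmx /= symx_tr; split=> [h|[_ h] v].
  by split=> // v; have := h v; rewrite mxdot_cV mulmxA.
by have := h v; rewrite mxdot_cV mulmxA.
Qed.

Lemma symx_of_sym n (M : 'M[R]_n) : M^T = M -> exists X : symx R n, X = M :> 'M[R]_n.
Proof.
move=> Ms; have h : M \in @symx_pred R n by rewrite symx_predE Ms.
by exists (Symx h).
Qed.

(** All factors of [X] have squared norm the trace of [X], so they form a compact set, on which the
    distance to [F] attains its minimum. *)
Lemma nearest_factor_exists n k (X : symx R n) (F0 F : 'M[R]_(n, k)) :
  gram F0 = X -> nearest_points (factors X) F !=set0.
Proof.
move=> F0X.
pose K := [set G : 'M[R]_(n, k) | nsq G <= mxdot 1%:M X] `&`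
  [set G : 'M[R]_(n, k) | nsq (G *m G^T - X) = 0].
have KE (G : 'M[R]_(n, k)) : gram G = X -> K G.
  move=> GX; have e : G *m G^T = X by rewrite -GX.
  by split; rewrite /= -e ?subrr /nsq ?mxdot0l // mxdot_gram mul1mx.
have cK : compact K.
  apply: compact_closedI; first exact: compact_nsq_ball.
  by apply: closed_eq_fun; continuity_mx.
have [||G [_ /= GX] Gmin] := @EVT_le _ _ K (fun G => nsq (F - G)) cK.
- by exists F0; exact: KE.
- by continuity_mx.
exists G; split.
  by apply: val_inj => /=; apply/eqP; rewrite -subr_eq0; apply/eqP; exact: nsq_eq0.
by move=> H HX; rewrite mxnormF_le; apply: Gmin; exact: KE.
Qed.

Section Data.
Variables (n m : nat) (A : {linear symx R n -> 'cV[R]_m}).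
Variables (Aadj : 'cV[R]_m -> symx R n) (C : symx R n) (b : 'cV[R]_m).
Hypothesis adj : is_adjoint A Aadj.

(** By adjointness these matrices represent the coordinates of [A], so that [opA] extends [A] to all
    square matrices. *)
Definition adj_rows (l : 'I_m) : 'M[R]_n := Aadj (delta_mx l 0).

Lemma adj_rows_sym l : (adj_rows l)^T = adj_rows l.
Proof. exact: symx_tr. Qed.

Lemma opA_adj_rows (X : symx R n) : A X = opA adj_rows X.
Proof.
apply/matrixP => l j; rewrite (ord1 j) mxE /adj_rows mxdotC -adj.
by rewrite mxdot_delta.
Qed.

Lemma slackE y : (slack Aadj C y : 'M[R]_n) = C - Aadj y.
Proof. by []. Qed.

Lemma mxdot_slack y (X : symx R n) :
  mxdot (slack Aadj C y) X = mxdot C X - mxdot (A X) y.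
Proof. by rewrite slackE mxdotBl (mxdotC (Aadj y)) -adj. Qed.

(** The additive constant does not involve [X], so minimizers and gradients carry over to
    [penal]. *)
Lemma lagrangian_penal (rho : R) (Xst X : symx R n) y y0 : 0 < rho -> A Xst = b ->
  lagrangian A C b rho X y =
  penal adj_rows (slack Aadj C y0) Xst rho X (rho^-1 *: (y - y0)) +
  (mxdot b y0 - rho / 2 * nsq (rho^-1 *: (y - y0))).
Proof.
move=> rho0 AX; rewrite /lagrangian /penal mxnormF_sqr -!opA_adj_rows AX mxdot_slack.
set u := A X - b; have -> : A X = u + b by rewrite subrK.
have -> : b - (u + b) = - u by rewrite opprD addrC subrK.
rewrite (nsqB u) mxdotNr mxdotZr mxdotBr mxdotDl (mxdotC y).
by field; rewrite gt_eqF.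
Qed.

End Data.
End Translation.

Theorem mainTheorem2 (R : realType) (n m k : nat)
    (A : {linear symx R n -> 'cV[R]_m}) (Aadj : 'cV[R]_m -> symx R n)
    (C : symx R n) (b : 'cV[R]_m) (rho : R)
    (Xstar : symx R n) (ystar : 'cV[R]_m) :
  is_adjoint A Aadj ->
  primal_simple A Aadj C b ->
  0 < rho ->
  strictly_complementary A Aadj C b Xstar ystar ->
  k = \rank Xstar ->
  exists c cbar chat q : R,
    [/\ 0 < c, 0 < cbar, 0 < chat, 0 < q < 1 &
      forall y : 'cV[R]_m, mxnormF (y - ystar) <= c ->
      exists Xy : symx R n,
        [/\ alp_solutions A C b rho y = [set Xy],
            forall G : 'M[R]_(n, k), nearest_points (factors Xy) G !=set0 &
            forall (eta : R) (F F0 : nat -> 'M[R]_(n, k)),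
              mxnormF (F 1%N *m (F 1%N)^T - Xstar) <= chat ->
              cbar / 2 < eta < cbar ->
              is_gradient_descent A C b rho eta y F ->
              (forall t : nat, (1 <= t)%N ->
                 nearest_points (factors Xy) (F t) (F0 t)) ->
              forall t : nat, (1 <= t)%N ->
                mxnormF (F t.+1 - F0 t.+1) <= q ^+ t * mxnormF (F 1%N - F0 1%N)]].
Proof.
move=> adj [[_ sd] _ [X0 X0E]] rho0 [Xy_opt rk] kE.
have CX := sd _ _ Xy_opt.
have [Xopt [pZ _]] := Xy_opt.
have [[AX pX] Xmin] := Xopt.
have compl : mxdot (slack Aadj C ystar) Xstar = 0.
  by rewrite (mxdot_slack C adj) CX AX subrr.
(* A feasible [X] orthogonal to the slack has objective value [<b, ystar>], hence is optimal and
   equals the unique solution. *)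
have uniq (X : 'M[R]_n) : psdmx X -> opA (adj_rows Aadj) X = opA (adj_rows Aadj) Xstar ->
    mxdot (slack Aadj C ystar) X = 0 -> X = Xstar.
  move=> pX'; have [X' X'E] := symx_of_sym (proj1 pX').
  rewrite -X'E -!(opA_adj_rows adj) (mxdot_slack C adj) AX => AX' ZX'.
  have X'opt : primal_solutions A C b X'.
    split=> [|W hW]; first by split => //; apply/symx_psd; rewrite X'E.
    apply: le_trans (Xmin W hW); rewrite CX.
    by move/eqP: ZX'; rewrite AX' subr_eq0 => /eqP ->.
  by move: X'opt Xopt; rewrite X0E => -> ->.
have [c [cbar [chat [q [c0 cb0 ch0 /andP[q0 q1] H]]]]] :=
  @local_contraction R n m k (adj_rows Aadj) (slack Aadj C ystar) Xstar rho
    (@adj_rows_sym _ _ _ Aadj) (proj1 (symx_psd _) pZ) (proj1 (symx_psd _) pX)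
    (esym kE) rk compl uniq rho0.
(* The square roots appear because [local_contraction] bounds squared norms; [rho] undoes the
   scaling in [d = (y - ystar) / rho]. *)
exists (rho * Num.sqrt c), cbar, (Num.sqrt chat), (Num.sqrt q).
split; [by rewrite mulr_gt0 // sqrtr_gt0|by []|by rewrite sqrtr_gt0| |].
  by rewrite sqrtr_gt0 q0 /= -sqrtr1 ltr_sqrt.
move=> y.
rewrite mxnormF_le_sqr; last by rewrite mulr_ge0 ?sqrtr_ge0 // ltW.
rewrite exprMn (sqr_sqrtr (ltW c0)) => hy.
pose d := rho^-1 *: (y - ystar).
have [|F0 [Fmin Funiq gd]] := H d.
  by rewrite nsqZ exprVn mulrC ler_pdivrMr ?exprn_gt0 // mulrC.
have lag X := lagrangian_penal C adj X y ystar rho0 AX.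
exists (gram F0); split.
- apply/seteqP; split=> X /=.
    move=> [pX' hX]; apply: val_inj => /=; apply: Funiq; first exact/symx_psd.
    have := hX (gram F0); rewrite !lag lerD2r; apply.
    by apply/symx_psd; exact: psdmx_gram.
  move=> ->; split=> [|W /symx_psd pW]; first by apply/symx_psd; exact: psdmx_gram.
  by rewrite !lag lerD2r; exact: Fmin.
- by move=> G; exact: (nearest_factor_exists G erefl).
move=> eta F G F1 heta Fstep Gnear t t1.
rewrite -(@ler_pXn2r _ 2) ?nnegrE ?mulr_ge0 ?exprn_ge0 ?sqrtr_ge0 //.
rewrite exprMn -exprM mulnC exprM (sqr_sqrtr (ltW q0)) !mxnormF_sqr.
apply: (gd eta F G) => // [|s s1|s s1].
- by move: F1; rewrite mxnormF_le_sqr ?sqrtr_ge0 // sqr_sqrtr // ltW.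
- rewrite Fstep //; congr (_ - eta *: _).
  rewrite (_ : (fun G => _) = fun G : 'M[R]_(n, k) =>
    penal (adj_rows Aadj) (slack Aadj C ystar) Xstar rho (G *m G^T) d +
    (mxdot b ystar - rho / 2 * nsq d)); last by apply/funext => W; rewrite /bm_lagrangian lag.
  by rewrite gradient_penal_gram //; [exact: adj_rows_sym|exact/symx_psd].
- have [GX Gmin] := Gnear s s1; split; first exact: (congr1 val GX).
  move=> W WX; rewrite -mxnormF_le; apply: Gmin.
  exact: val_inj.
Qed.
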